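(* Let $n\in\mathbb{Z}_{\ge 0}$, $l\in\mathbb{Z}_{>0}$, $\eta_l=\exp(2\pi i/l)$, $K=\mathbb{Q}(\eta_l)$, and let $(r_0,\ldots,r_{l-1},r)\in\mathbb{Z}^{l+1}$. Let $\varphi:\mathbb{Z}_K[\mathbf{q},\mathbf{q}^{-1}]\to\mathbb{Z}_K[y,y^{-1}]$ be the $\mathbb{Z}_K$-algebra morphism with $\varphi(Q_i)=\eta_l^{i}y^{r_i}$ for $0\le i\le l-1$ and $\varphi(q)=y^{r}$. Let $\eta$ be a non-zero complex number, algebraic over $K$, let $\Phi$ be its minimal polynomial over $K$, and let $\theta:\mathbb{Z}_K[y,y^{-1}]\to K(\eta)$ be the $\mathbb{Z}_K$-algebra morphism with $\theta(y)=\eta$. Let $\boldsymbol{\lambda},\boldsymbol{\mu}$ be $l$-partitions of $n$. If the simple modules $V^{\boldsymbol{\lambda}}$ and $V^{\boldsymbol{\mu}}$ of the cyclotomic Ariki--Koike algebra $K(y)(\mathcal{H}_n^{\mathbf{q}})_\varphi$ are in the same $\theta$-block, then they have the same $\Phi$-defect, that is, $$\nu_\Phi(\varphi(s_{\boldsymbol{\lambda}}(\mathbf{q})))=\nu_\Phi(\varphi(s_{\boldsymbol{\mu}}(\mathbf{q}))).$$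
   Context: $\mathbb{Z}_K$ is the ring of integers of $K$ and $\mathbf{q}=(Q_0,\ldots,Q_{l-1};q)$ is a set of $l+1$ indeterminates. **Ariki--Koike algebra.** $\mathcal{H}_n^{\mathbf{q}}$ is the associative unital $\mathbb{Z}[\mathbf{q},\mathbf{q}^{-1}]$-algebra (scalars extended to $\mathbb{Z}_K[\mathbf{q},\mathbf{q}^{-1}]$ when needed) with generators $T_0,\ldots,T_{n-1}$ and relations $\prod_{i=0}^{l-1}(T_0-Q_i)=0$; $(T_i-q)(T_i+1)=0$ for $1\le i\le n-1$; $T_0T_1T_0T_1=T_1T_0T_1T_0$; $T_iT_{i+1}T_i=T_{i+1}T_iT_{i+1}$ for $1\le i\le n-2$; $T_iT_j=T_jT_i$ for $0\le i<j\le n-1$ with $j-i>1$. $(\mathcal{H}_n^{\mathbf{q}})_\varphi$ is the $\mathbb{Z}_K[y,y^{-1}]$-algebra obtained by specialising the parameters via $\varphi$; $K(y)(\mathcal{H}_n^{\mathbf{q}})_\varphi$ is split semisimple. **Partitions and simple modules.** A partition $\lambda=(\lambda_1\ge\lambda_2\ge\cdots)$ has set of nodes $[\lambda]=\{(i,j): i\ge1,\ 1\le j\le\lambda_i\}$ and conjugate $\lambda'$, $\lambda'_k=\sharp\{i\ge 1:\lambda_i\ge k\}$. An $l$-partition of $n$ is $\boldsymbol{\lambda}=(\lambda^0,\ldots,\lambda^{l-1})$ with $\sum_j|\lambda^j|=n$. The simple modules of $\mathbb{Q}(\mathbf{q})\mathcal{H}_n^{\mathbf{q}}$ are labelled in the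 standard way by $l$-partitions of $n$: $V^{\boldsymbol{\lambda}}$ has a basis indexed by the standard tableaux of shape $\boldsymbol{\lambda}$, consisting of common eigenvectors of the elements $L_1=T_0$, $L_{k+1}=q^{-1}T_kL_kT_k$, where $L_k$ acts on the vector of a tableau with eigenvalue $q^{j-i}Q_a$ if $k$ occupies node $(i,j)$ of component $a$. By Tits's deformation theorem the simple modules of $K(y)(\mathcal{H}_n^{\mathbf{q}})_\varphi$ are labelled correspondingly (also denoted $V^{\boldsymbol{\lambda}}$). **Schur elements.** For partitions $\lambda,\mu$ and $(i,j)\in[\lambda]$, let $h_{i,j}^{\lambda,\mu}=\lambda_i-i+\mu'_j-j+1$. Let $N(\lambda)=\sum_{i\ge1}(i-1)\lambda_i$, let $\bar{\boldsymbol{\lambda}}$ be the partition of $n$ obtained by reordering all the parts of $\boldsymbol{\lambda}$, and $[k]_q=1+q+\cdots+q^{k-1}$. The Schur element of $V^{\boldsymbol{\lambda}}$ with respect to the canonical symmetrising trace of $\mathcal{H}_n^{\mathbf{q}}$ is $$s_{\boldsymbol{\lambda}}(\mathbf{q})=(-1)^{n(l-1)}q^{-N(\bar{\boldsymbol{\lambda}})}\prod_{0\le a\le l-1}\ \prod_{(i,j)\in[\lambda^a]}\Big([h_{i,j}^{\lambda^a,\lambda^a}]_q\prod_{0\le b\le l-1,\,b\ne a}\big(q^{h_{i,j}^{\lambda^a,\lambda^b}}Q_aQ_b^{-1}-1\big)\Big).$$ The Schur element of $V^{\boldsymbol{\lambda}}$ for $(\mathcal{H}_n^{\mathbf{q}})_\varphi$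 is $\varphi(s_{\boldsymbol{\lambda}}(\mathbf{q}))\neq 0$. $\nu_\Phi$ is the $\Phi$-adic valuation on $K(y)$; $\nu_\Phi(\varphi(s_{\boldsymbol{\lambda}}(\mathbf{q})))$ is the $\Phi$-defect of $V^{\boldsymbol{\lambda}}$. **$\theta$-blocks.** Write $H=(\mathcal{H}_n^{\mathbf{q}})_\varphi$. Let $\mathcal{O}\subset K(y)$ be the localisation of $\mathbb{Z}_K[y,y^{-1}]$ at $\mathrm{Ker}\,\theta$, a discrete valuation ring with uniformiser $\Phi$ and residue field $K(\eta)$ (via $y\mapsto\eta$). For a simple $K(y)H$-module $V$ choose an $\mathcal{O}H$-lattice $V_{\mathcal{O}}$ with $K(y)\otimes_{\mathcal{O}}V_{\mathcal{O}}\cong V$; for a simple $K(\eta)H$-module $M$ the decomposition number $[V:M]$ is the multiplicity of $M$ as a composition factor of $K(\eta)\otimes_{\mathcal{O}}V_{\mathcal{O}}$ (independent of the lattice). The Brauer graph has vertex set $\mathrm{Irr}(K(y)H)$, with $V,V'$ joined by an edge if some $M$ satisfies $[V:M]\ne0\ne[V':M]$. Its connected components are the $\theta$-blocks. *)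

(* Defs.v *)
From HB Require Import structures.
From mathcomp Require Import all_boot all_order all_algebra fieldext.
From mathcomp Require Import boolp reals trigo.
From mathcomp.real_closed Require Import complex.
From mathcomp Require Import mpoly.
From Stdlib Require Import Relation_Operators.

Set Implicit Arguments.
Unset Strict Implicit.
Unset Printing Implicit Defensive.

Import Order.TTheory GRing.Theory Num.Theory.
Local Open Scope ring_scope.
Local Notation "x %:F" := (tofrac x).


(** * Partitions and multipartitions *)

Definition is_partition (s : seq nat) : bool :=
  sorted geq s && (0%N \notin s).

Definition is_multipartition (n l : nat) (lam : 'I_l -> seq nat) : Prop :=
  (forall a, is_partition (lam a)) /\ (\sum_(a < l) sumn (lam a) = n)%N.

(* Rows, columns and parts are numbered from 1; [part s i] is used for
   [i >= 1] only. *)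
Definition part (s : seq nat) (i : nat) : nat := nth 0%N s i.-1.

Definition conj_part (s : seq nat) (k : nat) : nat := count (leq k) s.

Definition in_diagram (s : seq nat) (i j : nat) : bool :=
  [&& 0 < i, 0 < j & j <= part s i]%N.

Definition ghook (s t : seq nat) (i j : nat) : int :=
  (part s i)%:Z - i%:Z + (conj_part t j)%:Z - j%:Z + 1.

Definition partN (s : seq nat) : nat :=
  (\sum_(1 <= i < (size s).+1) i.-1 * part s i)%N.

Definition all_parts (l : nat) (lam : 'I_l -> seq nat) : seq nat :=
  sort geq (flatten [seq lam a | a <- enum 'I_l]).

(* A node (a, i, j) lies in row i and column j (from 1) of component a; all
   nodes of an l-partition of n have i, j <= n. *)
Definition node (n l : nat) : finType := ('I_l * 'I_n.+1 * 'I_n.+1)%type.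

(* [t k] is the node occupied by the number k + 1. Since a multipartition of
   n has n nodes, an injective filling of its nodes is bijective. *)
Definition is_std_tableau (n l : nat) (lam : 'I_l -> seq nat)
    (t : {ffun 'I_n -> node n l}) : bool :=
  [&& injectiveb t,
      [forall k, in_diagram (lam (t k).1.1) (t k).1.2 (t k).2],
      [forall k, forall k',
         [&& (t k).1.1 == (t k').1.1, (t k).1.2 == (t k').1.2 &
             ((t k).2 < (t k').2)%N] ==> (k < k')%N] &
      [forall k, forall k',
         [&& (t k).1.1 == (t k').1.1, (t k).2 == (t k').2 &
             ((t k).1.2 < (t k').1.2)%N] ==> (k < k')%N]].

Definition std_tableau (n l : nat) (lam : 'I_l -> seq nat) : finType :=
  {t : {ffun 'I_n -> node n l} | is_std_tableau lam t}.

(** * Modules over Ariki-Koike algebras *)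

(* The defining relations of the algebra, for matrices over F. *)
Definition AK_relations (F : fieldType) (n l : nat) (Q : 'I_l -> F) (q : F)
    (d : nat) (T : 'I_n -> 'M[F]_d) : Prop :=
  [/\ forall i : 'I_n, i = 0%N :> nat -> \prod_(a < l) (T i - (Q a)%:M) = 0,
      forall i : 'I_n, (0 < i)%N -> (T i - q%:M) * (T i + 1) = 0,
      forall i j : 'I_n, i = 0%N :> nat -> j = 1%N :> nat ->
        T i * T j * T i * T j = T j * T i * T j * T i,
      forall i j : 'I_n, (0 < i)%N -> j = i.+1 :> nat ->
        T i * T j * T i = T j * T i * T j &
      forall i j : 'I_n, (i.+1 < j)%N -> T i * T j = T j * T i].

(* A finite-dimensional module over the algebra presented by generators
   T_0, ..., T_(n-1) and [AK_relations] is a tuple of matrices satisfying these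
   relations. The matrices act on row vectors from the right, as in
   mxrepresentation; the relations, and the elements L_k below, are palindromic
   in the T_i, so right and left modules are the same data. *)
Record AK_module (F : fieldType) (n l : nat) (Q : 'I_l -> F) (q : F) :=
  AKModule {
    dimM : nat;
    act : 'I_n -> 'M[F]_dimM;
    actP : AK_relations Q q act
  }.

Section Modules.

Variables (F : fieldType) (n l : nat) (Q : 'I_l -> F) (q : F).
Implicit Types M N V : AK_module n Q q.

Definition stable M (U : 'M[F]_(dimM M)) : Prop :=
  forall i, stablemx U (act M i).

Definition simple M : Prop :=
  (0 < dimM M)%N /\
  forall U : 'M[F]_(dimM M), stable U -> \rank U = 0%N \/ row_full U.

Definition iso M N : Prop :=
  exists P : 'M[F]_(dimM M, dimM N),
    [/\ row_free P, row_full P & forall i, act M i *m P = P *m act N i].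

(* For submodules U <= W of M: the quotient W / U is isomorphic to N, the
   isomorphism being induced by the linear map A restricted to W. *)
Definition subquotient M (U W : 'M[F]_(dimM M)) N : Prop :=
  (U <= W)%MS /\
  exists A : 'M[F]_(dimM M, dimM N),
    [/\ row_full (W *m A), (W :&: kermx A == U)%MS &
        forall i, W *m act M i *m A = W *m A *m act N i].

Definition composition_series M (k : nat) (U : nat -> 'M[F]_(dimM M))
    (S : 'I_k -> AK_module n Q q) : Prop :=
  [/\ U 0%N = 0, U k = 1%:M, forall i, (i <= k)%N -> stable (U i) &
      forall i : 'I_k, simple (S i) /\ subquotient (U i) (U i.+1) (S i)].

Definition composition_multiplicity M N (m : nat) : Prop :=
  exists k U S, @composition_series M k U S /\
    m = #|[pred i : 'I_k | `[< iso (S i) N >]]|.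

Definition word_trace M (w : seq 'I_n) : F := \tr (\prod_(i <- w) act M i).

(* [JM M k] is L_(k+1); it is only meaningful for k < n. *)
Definition gen M (k : nat) : 'M[F]_(dimM M) := oapp (act M) 0 (insub k).

Fixpoint JM M (k : nat) : 'M[F]_(dimM M) :=
  if k is k'.+1 then q^-1 *: (gen M k *m JM M k' *m gen M k) else gen M 0.

Definition content (x : node n l) : F :=
  q ^ (x.2%:Z - x.1.2%:Z) * Q x.1.1.

Definition has_seminormal_basis (lam : 'I_l -> seq nat) M : Prop :=
  exists b : std_tableau n lam -> 'rV[F]_(dimM M),
    basis_of fullv (codom b) /\
    forall t (k : 'I_n), b t *m JM M k = content (val t k) *: b t.

End Modules.

(** * Schur elements *)

Section Schur.

Variables (F : fieldType) (n l : nat) (Q : 'I_l -> F) (q : F).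

(* Only used for k >= 0: the hook lengths of a partition are positive. *)
Definition qint (k : int) : F := \sum_(0 <= i < `|k|) q ^+ i.

(* The Laurent polynomial s_lambda evaluated at the parameters (Q, q). *)
Definition schur_element (lam : 'I_l -> seq nat) : F :=
  (-1) ^+ (n * l.-1) * q ^ (- (partN (all_parts lam))%:Z) *
  \prod_(a < l)
    \prod_(1 <= i < (size (lam a)).+1) \prod_(1 <= j < (part (lam a) i).+1)
      (qint (ghook (lam a) (lam a) i j) *
       \prod_(b < l | b != a)
         (q ^ (ghook (lam a) (lam b) i j) * Q a * (Q b)^-1 - 1)).

End Schur.

(** * The cyclotomic specialisation *)

Definition cycl_Q (F : fieldType) (l : nat) (rs : 'I_l -> int) (zeta y : F)
  : 'I_l -> F := fun i => zeta ^+ i * y ^ (rs i).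

Definition cycl_q (F : fieldType) (r : int) (y : F) : F := y ^ r.

(* The generic parameters: variable number a < l is Q_a, variable number l
   is q. *)
Definition gen_field (l : nat) : fieldType := {fraction {mpoly int[l.+1]}}.

Definition gen_Q (l : nat) : 'I_l -> gen_field l :=
  fun a => ('X_(widen_ord (leqnSn l) a) : {mpoly int[l.+1]})%:F.

Definition gen_q (l : nat) : gen_field l :=
  ('X_(ord_max) : {mpoly int[l.+1]})%:F.

(* The ring morphism Z[Q_0, ..., Q_(l-1), q] -> F sending the variables to the
   given values. *)
Definition spec_poly (F : fieldType) (l : nat) (Q : 'I_l -> F) (q : F)
    (p : {mpoly int[l.+1]}) : F :=
  mmap (intr : int -> F)
    (fun i => if unlift ord_max i is Some a then Q a else q) p.

(* x is a Laurent polynomial with integer coefficients in the generic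
   parameters, and z is its value at (Q, q), all of Q_a and q being
   invertible. *)
Definition specialises_to (F : fieldType) (l : nat) (Q : 'I_l -> F) (q : F)
    (x : gen_field l) (z : F) : Prop :=
  exists (p : {mpoly int[l.+1]}) (m : 'X_{1..l.+1}),
    x = p%:F / ('X_[m] : {mpoly int[l.+1]})%:F /\
    z = spec_poly Q q p / spec_poly Q q 'X_[m].

Definition gen_module (n l : nat) := AK_module n (@gen_Q l) (gen_q l).

Definition is_generic_simple (n l : nat) (lam : 'I_l -> seq nat)
    (V : gen_module n l) : Prop :=
  simple V /\ has_seminormal_basis lam V.

(* Labelling through Tits's deformation theorem: the character of V^lambda
   for the specialised algebra is the specialisation of the character of the
   generic V^lambda. Eigenvalues of the L_k alone would not do, as they need
   not separate the modules of the specialised algebra. *)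
Definition is_simple_labelled (F : fieldType) (n l : nat) (Q : 'I_l -> F)
    (q : F) (lam : 'I_l -> seq nat) (V : AK_module n Q q) : Prop :=
  simple V /\
  exists2 W : gen_module n l, is_generic_simple lam W &
    forall w : seq 'I_n, specialises_to Q q (word_trace W w) (word_trace V w).

(** * The fields K, K(y), K(eta) and the map theta *)

Definition eta_l (R : realType) (l : nat) : R[i] :=
  (cos (2 * pi / l%:R) +i* sin (2 * pi / l%:R))%C.

(* K = Q(eta_l). *)
Definition cycl_field (R : realType) (l : nat) : fieldType :=
  subFExtend (@ratr R[i]) (eta_l R l) ('X^l - 1).

Definition cycl_emb (R : realType) (l : nat) :
    {rmorphism cycl_field R l -> R[i]} :=
  @subfx_inj _ _ (@ratr R[i]) (eta_l R l) ('X^l - 1).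

(* eta_l as an element of K. *)
Definition cycl_root (R : realType) (l : nat) : cycl_field R l :=
  subfx_root (@ratr R[i]) (eta_l R l) ('X^l - 1).

Definition is_min_poly (K L : fieldType) (iota : {rmorphism K -> L}) (eta : L)
    (Phi : {poly K}) : Prop :=
  [/\ Phi \is monic, root (map_poly iota Phi) eta &
      forall p : {poly K}, p != 0 -> root (map_poly iota p) eta ->
        (size Phi <= size p)%N].

Section Theta.

Variables (K L : fieldType) (iota : {rmorphism K -> L}) (eta : L).
Variable Phi : {poly K}.

Definition ratfun : fieldType := {fraction {poly K}}.

Definition ratC (c : K) : ratfun := (c%:P)%:F.

Definition ratX : ratfun := ('X : {poly K})%:F.

(* K(eta), with Phi the minimal polynomial of eta. *)
Definition adj_field : fieldType := subFExtend iota eta Phi.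

Definition adjC : K -> adj_field := inj_subfx iota eta Phi.

Definition adj_root : adj_field := subfx_root iota eta Phi.

Definition alg_int (c : K) : Prop := integralOver (intr : int -> K) c.

(* f lies in Z_K[y, 1/y] and theta(f) = b. *)
Definition theta (f : ratfun) (b : adj_field) : Prop :=
  exists (p : {poly K}) (m : nat),
    [/\ forall i, alg_int p`_i, f = p%:F / ratX ^+ m &
        b = (map_poly adjC p).[adj_root] / adj_root ^+ m].

(* x lies in the localisation O of Z_K[y, 1/y] at Ker(theta), and its image in
   the residue field K(eta) is b. *)
Definition residue (x : ratfun) (b : adj_field) : Prop :=
  exists f g b1 b2,
    [/\ theta f b1, theta g b2, b2 != 0, x = f / g & b = b1 / b2].

(* Exponent of Phi in p, for p != 0. *)
Definition poly_mult (p : {poly K}) : nat :=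
  \max_(m < size p | Phi ^+ m %| p) m.

(* The Phi-adic valuation of x, for x != 0. *)
Definition valuation (x : ratfun) : int :=
  (poly_mult \n_(repr x))%:Z - (poly_mult \d_(repr x))%:Z.

End Theta.

(** * Blocks *)

Section Blocks.

Variables (K L : fieldType) (iota : {rmorphism K -> L}) (eta : L).
Variables (Phi : {poly K}) (zeta : K).
Variables (n l : nat) (rs : 'I_l -> int) (r : int).

Definition Ky_module : Type :=
  AK_module n (cycl_Q rs (ratC zeta) (ratX K)) (cycl_q r (ratX K)).

Definition Keta_module : Type :=
  AK_module n (cycl_Q rs (adjC iota eta Phi zeta) (adj_root iota eta Phi))
    (cycl_q r (adj_root iota eta Phi)).

(* O being a discrete valuation ring, a lattice in V is free: it is the O-span
   of the rows of an invertible P. The matrices A i give the action of T_i in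
   this basis; their entries must lie in O, and N is the reduction of the
   lattice. *)
Definition lattice_reduction (V : Ky_module) (N : Keta_module) : Prop :=
  exists (P : 'M[ratfun K]_(dimM N, dimM V))
         (A : 'I_n -> 'M[ratfun K]_(dimM N)),
    [/\ row_free P, row_full P, forall i, P *m act V i = A i *m P &
        forall i j k, residue (A i j k) (act N i j k)].

(* m = [V : M]. *)
Definition decomposition_number (V : Ky_module) (M : Keta_module) (m : nat) :
    Prop :=
  exists2 N : Keta_module, lattice_reduction V N &
    composition_multiplicity N M m.

Definition brauer_edge (V W : Ky_module) : Prop :=
  exists (M : Keta_module) (m m' : nat),
    [/\ simple M, decomposition_number V M m, decomposition_number W M m',
        m != 0%N & m' != 0%N].

(* The vertices are isomorphism classes of simple modules, represented here
   by the simple modules themselves: hence the [iso] disjunct. *)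
Definition brauer_adjacent (V W : Ky_module) : Prop :=
  [/\ simple V, simple W & iso V W \/ brauer_edge V W].

Definition same_theta_block : Ky_module -> Ky_module -> Prop :=
  clos_refl_sym_trans Ky_module brauer_adjacent.

End Blocks.

(* Main.v *)
Require Import Defs.
From mathcomp.real_closed Require Import complex.
From mathcomp Require Import all_boot all_order all_algebra fieldext mpoly.
From mathcomp Require Import reals trigo.
From mathcomp Require Import zify ring lra.
From Stdlib Require Import Relation_Operators.

Set Implicit Arguments.
Unset Strict Implicit.
Unset Printing Implicit Defensive.

Import Order.TTheory GRing.Theory Num.Theory.
Local Open Scope ring_scope.
Local Notation "x %:F" := (tofrac x).

(** Write L_1, ..., L_n for the Jucys-Murphy elements. Their power sums
    p_j = L_1^j + ... + L_n^j are central, so p_j acts on a simple module V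
    over K(y) by a scalar as soon as it has an eigenvalue in K(y). It has one:
    L_1 = T_0 is killed by the product of the T_0 - Q_a, and an intertwining
    operator shows that an eigenvalue of L_(k+1) is an eigenvalue of L_k or
    q^(+-1) times one, so all L_k have their eigenvalues among the q^i Q_a and,
    since they commute, a common eigenvector ([jm_joint_eigenvector]).
    These eigenvalues are units of O. Hence the scalar c_j of p_j on V lies in
    O, every reduction of a lattice in V carries the scalar theta(c_j), and so
    does each of its composition factors. Modules joined by an edge of the
    Brauer graph share a composition factor, so the theta(c_j) are constant on
    a block ([same_block_residue]).

    On V^lambda the scalar c_j is the j-th power sum of the contents
    q^(j-i) Q_a of the nodes of lambda: this is visible on the seminormal
    basis of the generic module, and traces carry it to the specialised one
    ([labelled_psum]). A block therefore determines all power sums of the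
    residues theta(q^(j-i) Q_a), hence, in characteristic 0, the multiset of
    residues ([same_block_perm_eq]).

    It remains to read the defect off this multiset. Up to units and apart
    from the numbers [h]_q with phi(q) = 1, each factor of the Schur element is a
    quotient of polynomials c y^N - 1 with c y^N not 1; these have simple
    roots only. So a hook h in component a, read against component b,
    contributes 1 if theta(q^h Q_a) = theta(Q_b) and 0 otherwise; if
    theta(q) = 1 the factors with a = b never vanish, which lowers the count
    by n for all lambda alike ([schur_defect_hook_count]). Counted
    symmetrically in (a, b), the vanishing factors are governed by

      sum_x q^(h(x)) + sum_y q^(-h(y))
        = sum_x q^(c(x)) + sum_y q^(-c(y))
          - (2 - q - q^-1) sum_(x, y) q^(c(x) - c(y)),

    where x runs over the nodes of one partition and y over those of another,
    h is the hook length read against the other partition and c the column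
    minus the row ([hook_content_identity]). The right-hand side turns the
    count into a function of the residues alone ([hook_count_residues]). *)

(** * An identity between hook lengths and contents of two partitions *)

(** Rows and columns are numbered from 0 and a partition is given by its row
    lengths b 0, ..., b (n - 1); the conjugate partition is then a sum of
    indicators, which grows by at most one when a last row is added. *)
Definition conj_row (b : nat -> nat) (n j : nat) : nat :=
  (\sum_(k < n) (j < b k))%N.

Section HookContent.
Implicit Types (a b : nat -> nat) (f : int -> int).

Lemma conj_rowS b n j : conj_row b n.+1 j = (conj_row b n j + (j < b n))%N.
Proof. exact: big_ord_recr. Qed.

Lemma conj_row_full b n j : (forall k, k < n -> j < b k)%N -> conj_row b n j = n.
Proof.
move=> jb; rewrite /conj_row (eq_bigr (fun=> 1%N)); first by rewrite sum1_card card_ord.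
by move=> k _; rewrite jb.
Qed.

Lemma conj_row_gt b n i j :
  {homo b : i j / (i <= j)%N >-> (j <= i)%N} ->
  (i < n)%N -> (j < b i)%N -> (i < conj_row b n j)%N.
Proof.
move=> b_mono; elim: n => // n IHn; rewrite ltnS leq_eqVlt => /orP[/eqP-> jb|in' jb].
  by rewrite conj_row_full // => k; rewrite ltnS => /b_mono; apply: leq_trans.
by rewrite conj_rowS (leq_trans (IHn in' jb)) // leq_addr.
Qed.

Lemma telescope_down f (z : int) m :
  \sum_(j < m) (f (z - j%:Z) - f (z - j%:Z - 1)) = f z - f (z - m%:Z).
Proof.
elim: m => [|m IHm]; first by rewrite big_ord0 subr0 subrr.
rewrite big_ord_recr IHm /= addrA subrK; congr (f z - f _); lia.
Qed.

Lemma telescope_up f (z : int) m :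
  \sum_(j < m) (f (z + j%:Z) - f (z + j%:Z + 1)) = f z - f (z + m%:Z).
Proof.
elim: m => [|m IHm]; first by rewrite big_ord0 addr0 subrr.
rewrite big_ord_recr IHm /= addrA subrK; congr (f z - f _); lia.
Qed.

Lemma sum_ord_min (p q : nat) (F : nat -> int) :
  \sum_(j < p) (if (j < q)%N then F j else 0) = \sum_(j < minn p q) F j.
Proof.
rewrite -big_mkcond (big_ord_widen p F (geq_minl p q)).
by apply: eq_bigl => j; rewrite leq_min ltn_ord.
Qed.

(** Both sides change by the same telescoping sum when a last row is added to
    b. For f an indicator function this says that the numbers
    p + b'_j - j (0 <= j < p) and (p - b_i) + i + 1, the latter with truncated
    subtraction, together fill 1, ..., p + n. *)
Lemma row_hooks f b n p :
  {homo b : i j / (i <= j)%N >-> (j <= i)%N} ->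
  \sum_(j < p) f ((p + conj_row b n j)%:Z - j%:Z) =
  \sum_(j < p) f (j.+1)%:Z
  + \sum_(i < n) (f (p + i.+1)%:Z - f ((p - b i) + i.+1)%:Z).
Proof.
move=> b_mono; elim: n => [|n IHn].
  rewrite big_ord0 addr0 [RHS](reindex_inj rev_ord_inj) /=.
  apply: eq_bigr => j _; rewrite /conj_row big_ord0; congr f.
  by have := ltn_ord j; lia.
rewrite [X in _ + X]big_ord_recr /= addrA -IHn.
apply/eqP; rewrite addrC -subr_eq -sumrB; apply/eqP.
transitivity (\sum_(j < minn p (b n))
    (f ((p + n.+1)%:Z - j%:Z) - f ((p + n.+1)%:Z - j%:Z - 1))).
  rewrite -(sum_ord_min _ _
    (fun j => f ((p + n.+1)%:Z - j%:Z) - f ((p + n.+1)%:Z - j%:Z - 1))).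
  apply: eq_bigr => j _; rewrite conj_rowS.
  case: ltnP => [jb|_]; last by rewrite addn0 subrr.
  rewrite conj_row_full => [|k]; last first.
    by move=> /ltnW/b_mono; apply: leq_trans.
  by congr (f _ - f _); lia.
by rewrite telescope_down; congr (_ - f _); lia.
Qed.

(** On f k = q^k this is multiplication by 2 - q - q^-1. *)
Definition diff2 f (k : int) : int := 2 * f k - f (k + 1) - f (k - 1).

Lemma sum_diff2 f (z : int) p m :
  \sum_(j < p) \sum_(j' < m) diff2 f (z + j%:Z - j'%:Z) =
  f (z + p%:Z - m%:Z) - f (z + p%:Z) - f (z - m%:Z) + f z.
Proof.
have row w : \sum_(j' < m) diff2 f (w - j'%:Z) =
    f w - f (w + 1) - f (w - m%:Z) + f (w + 1 - m%:Z).
  elim: m => [|m IHm]; first by rewrite big_ord0 !subr0; ring.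
  rewrite big_ord_recr IHm /diff2 /=.
  rewrite (_ : w - m.+1%:Z = w - m%:Z - 1); last lia.
  rewrite (_ : w + 1 - m.+1%:Z = w - m%:Z); last lia.
  rewrite (_ : w - m%:Z + 1 = w + 1 - m%:Z); last lia.
  by ring.
elim: p => [|p IHp]; first by rewrite big_ord0 !addr0; ring.
rewrite big_ord_recr IHp row /=.
rewrite (_ : z + p.+1%:Z = z + p%:Z + 1); last lia.
by ring.
Qed.

Definition box_sum (a : nat -> nat) (m : nat) (F : nat -> nat -> int) : int :=
  \sum_(i < m) \sum_(j < a i) F i j.

(** The identity of Laurent polynomials stated at the beginning, with an
    arbitrary function f in place of k |-> q^k. The proof adds the rows of a
    one at a time: the new last row lengthens the columns of a that it meets,
    which changes the hooks of b, and brings its own hooks, contents and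
    differences of contents; all of these changes telescope along rows. *)
Lemma hook_content_identity f a b m n :
  {homo a : i j / (i <= j)%N >-> (j <= i)%N} ->
  {homo b : i j / (i <= j)%N >-> (j <= i)%N} ->
  box_sum a m (fun i j => f ((a i + conj_row b n j)%:Z - (i + j).+1%:Z))
  + box_sum b n (fun i j => f (- ((b i + conj_row a m j)%:Z - (i + j).+1%:Z)))
  = box_sum a m (fun i j => f (j%:Z - i%:Z))
    + box_sum b n (fun i j => f (i%:Z - j%:Z))
    - box_sum a m (fun i j => box_sum b n (fun i' j' =>
        diff2 f ((j%:Z - i%:Z) - (j'%:Z - i'%:Z)))).
Proof.
move=> a_mono b_mono; elim: m => [|m IHm].
  rewrite /box_sum !big_ord0 !add0r subr0.
  apply: eq_bigr => i _.
  rewrite (reindex_inj rev_ord_inj) /=; apply: eq_bigr => j _; congr f.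
  by rewrite /conj_row big_ord0; have := ltn_ord j; lia.
have recr F : box_sum a m.+1 F = box_sum a m F + \sum_(j < a m) F m j.
  exact: big_ord_recr.
rewrite !recr.
(* the effect of the new row of a on the hooks of b *)
have low : box_sum b n
    (fun i j => f (- ((b i + conj_row a m.+1 j)%:Z - (i + j).+1%:Z))) =
  box_sum b n (fun i j => f (- ((b i + conj_row a m j)%:Z - (i + j).+1%:Z)))
  + \sum_(i < n) (f (i%:Z - m%:Z - (b i)%:Z)
       - f (i%:Z - m%:Z - (b i)%:Z + (minn (a m) (b i))%:Z)).
  rewrite /box_sum -big_split; apply: eq_bigr => i _ /=.
  apply/eqP; rewrite addrC -subr_eq -sumrB; apply/eqP.
  rewrite minnC -telescope_up -(sum_ord_min _ _ (fun j =>
    f (i%:Z - m%:Z - (b i)%:Z + j%:Z) - f (i%:Z - m%:Z - (b i)%:Z + j%:Z + 1))).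
  apply: eq_bigr => j _.
  rewrite conj_rowS; case: ltnP => [jam|_]; last by rewrite addn0 subrr.
  rewrite conj_row_full => [|k]; last first.
    by move=> /ltnW/a_mono; apply: leq_trans.
  by congr (f _ - f _); lia.
rewrite low.
(* the hooks of the new row itself *)
have top : \sum_(j < a m) f ((a m + conj_row b n j)%:Z - (m + j).+1%:Z) =
  \sum_(j < a m) f (j%:Z - m%:Z) + \sum_(i < n)
   (f ((a m)%:Z + i%:Z - m%:Z) - f ((a m - b i)%N%:Z + i%:Z - m%:Z)).
  have := row_hooks (fun k => f (k - m.+1%:Z)) n (a m) b_mono.
  rewrite (eq_bigr (fun j : 'I__ =>
    f ((a m + conj_row b n j)%:Z - (m + j).+1%:Z))); last first.
    by move=> j _; congr f; lia.
  move->; congr (_ + _); first by apply: eq_bigr => j _; congr f; lia.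
  by apply: eq_bigr => i _; congr (f _ - f _); lia.
(* the new differences of contents *)
have cross : \sum_(j < a m) box_sum b n (fun i' j' =>
     diff2 f (j%:Z - m%:Z - (j'%:Z - i'%:Z))) = \sum_(i < n)
   (f ((a m)%:Z + i%:Z - m%:Z - (b i)%:Z) - f ((a m)%:Z + i%:Z - m%:Z)
    - f (i%:Z - m%:Z - (b i)%:Z) + f (i%:Z - m%:Z)).
  rewrite exchange_big /=; apply: eq_bigr => i _.
  rewrite (_ : (a m)%:Z + i%:Z - m%:Z = i%:Z - m%:Z + (a m)%:Z); last by lia.
  rewrite -sum_diff2; apply: eq_bigr => j _; apply: eq_bigr => j' _.
  by congr (diff2 f _); lia.
rewrite top cross.
have key : \sum_(i < n)
   (f ((a m)%:Z + i%:Z - m%:Z) - f ((a m - b i)%N%:Z + i%:Z - m%:Z))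
  + \sum_(i < n) (f (i%:Z - m%:Z - (b i)%:Z)
       - f (i%:Z - m%:Z - (b i)%:Z + (minn (a m) (b i))%:Z))
  = - \sum_(i < n)
   (f ((a m)%:Z + i%:Z - m%:Z - (b i)%:Z) - f ((a m)%:Z + i%:Z - m%:Z)
    - f (i%:Z - m%:Z - (b i)%:Z) + f (i%:Z - m%:Z)).
  rewrite -sumrN -big_split; apply: eq_bigr => i _ /=.
  case: (leqP (a m) (b i)) => ab.
    rewrite (_ : (a m - b i)%N = 0%N) ?add0r; last by lia.
    rewrite (_ : i%:Z - m%:Z - (b i)%:Z + (a m)%:Z =
                 (a m)%:Z + i%:Z - m%:Z - (b i)%:Z); last lia.
    ring.
  rewrite subrK (_ : (a m - b i)%N%:Z + i%:Z - m%:Z =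
               (a m)%:Z + i%:Z - m%:Z - (b i)%:Z); last lia.
  ring.
move: IHm key; move: (\sum_(i < n) _) (\sum_(i < n) _) (\sum_(i < n) _) => A B C.
move: (box_sum _ _ _) (box_sum _ _ _) (box_sum _ _ _) (box_sum _ _ _) (box_sum _ _ _).
lia.
Qed.

End HookContent.

(** * Jucys-Murphy elements and the centrality of their power sums *)

Section MatrixRing.
Variables (F : fieldType) (d : nat).
Implicit Types (A B C : 'M[F]_d) (c : F).

Lemma mxZl c A B : (c *: A) * B = c *: (A * B).
Proof. by rewrite -!mulmxE scalemxAl. Qed.

Lemma mxZr c A B : A * (c *: B) = c *: (A * B).
Proof. by rewrite -!mulmxE scalemxAr. Qed.

Lemma commZ c A B : GRing.comm A B -> GRing.comm A (c *: B).
Proof. by rewrite /GRing.comm mxZl mxZr => ->. Qed.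

Lemma comm_scalar A c : GRing.comm A c%:M.
Proof. exact: scalar_mxC. Qed.

Lemma scalar_mulr c A : c%:M * A = c *: A.
Proof. exact: mul_scalar_mx. Qed.

Lemma mulr_scalar c A : A * c%:M = c *: A.
Proof. exact: mul_mx_scalar. Qed.

(** The intertwining operator of the affine Hecke algebra generated by t, x
    and y. It transports the eigenvalues of y to eigenvalues of x, except where
    y = q x or y = q^-1 x. *)
Lemma intertwiner (q : F) (x y t : 'M[F]_d) :
  q != 0 -> GRing.comm x y -> t * t = (q - 1) *: t + q%:M ->
  t * y = (q - 1) *: y + x * t -> y * t = (q - 1) *: y + t * x ->
  exists2 tau, tau * x = y * tau &
    tau * tau = (- q) *: ((y - q *: x) * (y - q^-1 *: x)).
Proof.
move=> q_neq0 xy tt ty yt.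
pose tau := t * (x - y) + (q - 1) *: y.
have cx : (x - y) * x = x * (x - y) by rewrite mulrBl mulrBr xy.
have cy : (x - y) * y = y * (x - y) by rewrite mulrBl mulrBr xy.
have tauX : tau * x = y * tau.
  rewrite /tau mulrDl -mulrA cx mxZl [RHS]mulrDr [in RHS]mulrA yt.
  rewrite [in RHS]mulrDl !mxZl mxZr (mulrBr y) scalerBr mulrA.
  by rewrite addrAC subrK addrC.
have tauY : tau * y = x * tau.
  rewrite /tau mulrDl -mulrA cy mulrA ty mxZl [RHS]mulrDr [in LHS]mulrDl.
  rewrite mxZl mxZr (mulrBr y) scalerBr mulrA.
  by rewrite addrAC subrK addrC xy.
have t_tau : t * tau = (q - 1) *: (t * x) + q *: (x - y).
  rewrite /tau mulrDr mulrA tt mxZr mulrDl mxZl scalar_mulr (mulrBr t).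
  by rewrite scalerBr addrAC subrK.
have tau2 : tau * tau = (- q) *: ((y - q *: x) * (y - q^-1 *: x)).
  transitivity (t * tau * (y - x) + (q - 1) *: (tau * x)).
    rewrite -mulrA mulrBr tauX tauY -mulrBl mulrA -mxZl -mulrDl.
    by [].
  rewrite t_tau /tau.
  rewrite !(mulrDl, mulrDr, mulrBl, mulrBr, mxZl, mxZr, mulNr, mulrN) -!mulrA -!xy.
  move: (t * (x * x)) (t * (x * y)) (x * x) (x * y) (y * y) => A B C D E.
  by apply/matrixP => i j; rewrite !mxE; field.
exists tau; [exact: tauX | exact: tau2].
Qed.

End MatrixRing.

Section JucysMurphy.
Variables (F : fieldType) (q : F) (d : nat) (T : nat -> 'M[F]_d).

Fixpoint jm (k : nat) : 'M[F]_d :=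
  if k is k'.+1 then q^-1 *: (T k * jm k' * T k) else T 0%N.

Definition jm_psum (n j : nat) : 'M[F]_d := \sum_(k < n) jm k ^+ j.

Variable n : nat.
Hypothesis q_neq0 : q != 0.
Hypothesis T_quad : forall i, (0 < i < n)%N -> (T i - q%:M) * (T i + 1) = 0.
Hypothesis T_braid0 : T 0 * T 1 * T 0 * T 1 = T 1 * T 0 * T 1 * T 0.
Hypothesis T_braid :
  forall i, (0 < i)%N -> T i * T i.+1 * T i = T i.+1 * T i * T i.+1.
Hypothesis T_far : forall i j, (i.+1 < j)%N -> T i * T j = T j * T i.

Lemma comm_T_jm_above i k : (k.+1 < i)%N -> GRing.comm (T i) (jm k).
Proof.
elim: k => [|k IHk] ki /=; first by apply/esym/T_far.
apply/commZ/commrM; last by apply/esym/T_far.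
by apply: commrM; [apply/esym/T_far | apply: IHk; lia].
Qed.

(** T_i lies in the middle of the word that defines a later Jucys-Murphy
    element; two braid moves carry it through that word. *)
Lemma comm_T_jm_below i k : (i < k)%N -> GRing.comm (T i) (jm k).
Proof.
elim: k => // k IHk; rewrite ltnS leq_eqVlt => /orP[/eqP->|ik]; last first.
  by apply/commZ/commrM; [apply: commrM; [|exact: IHk]|]; apply: T_far.
apply: commZ; case: k {IHk} => [|k] /=.
  by rewrite /GRing.comm !mulrA T_braid0.
rewrite mxZr mxZl; apply: commZ.
have far : GRing.comm (T k.+2) (jm k) by exact: comm_T_jm_above.
rewrite /GRing.comm !mulrA T_braid // -!mulrA; congr (_ * (_ * _)).
rewrite mulrA far -mulrA; congr (_ * _).
by rewrite !mulrA T_braid.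
Qed.

Lemma comm_jm i k : GRing.comm (jm i) (jm k).
Proof.
wlog: i k / (i < k)%N.
  by move=> H; case: (ltngtP i k) => [/H //|/H/esym //|->].
elim: i => [|i IHi] ik; apply: commr_sym; first exact/esym/comm_T_jm_below.
have cT : GRing.comm (jm k) (T i.+1) by apply/commr_sym/comm_T_jm_below.
apply/commZ/commrM => //; apply: commrM => //.
by apply/commr_sym/IHi/ltnW.
Qed.

Lemma T_sqr i : (0 < i < n)%N -> T i * T i = (q - 1) *: T i + q%:M.
Proof.
move=> /T_quad/eqP; rewrite mulrDr mulr1 mulrBl scalar_mulr.
rewrite -addrA addr_eq0 => /eqP->.
by rewrite opprD opprK opprB scalerBl scale1r -[RHS]addrA [q%:M - _]addrC.
Qed.

Lemma T_jmS i : (0 < i.+1 < n)%N ->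
  T i.+1 * jm i.+1 = (q - 1) *: jm i.+1 + jm i * T i.+1.
Proof.
move=> iln; rewrite /= mxZr !mulrA T_sqr // !mulrDl !mxZl.
rewrite scalar_mulr mxZl.
by rewrite scalerDr !scalerA mulVf // scale1r [q^-1 * _]mulrC.
Qed.

Lemma jmS_T i : (0 < i.+1 < n)%N ->
  jm i.+1 * T i.+1 = (q - 1) *: jm i.+1 + T i.+1 * jm i.
Proof.
move=> iln; rewrite /= mxZl -!mulrA T_sqr // !mulrDr !mxZr.
rewrite mulr_scalar mxZr.
by rewrite scalerDr !scalerA mulVf // scale1r [q^-1 * _]mulrC.
Qed.

(** t commutes with x + y and with x y, hence, by Newton's recurrence, with all
    power sums of x and y. *)
Lemma comm_T_pair i j : (0 < i.+1 < n)%N ->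
  GRing.comm (T i.+1) (jm i ^+ j + jm i.+1 ^+ j).
Proof.
move=> iln; set x := jm i; set y := jm i.+1; set t := T i.+1.
have xy : GRing.comm x y by exact: comm_jm.
have csum : GRing.comm t (x + y).
  rewrite /GRing.comm mulrDr mulrDl T_jmS // jmS_T //.
  by rewrite addrCA [RHS]addrCA; congr (_ + _); exact: addrC.
have cprod : GRing.comm t (x * y).
  have yE : y = q^-1 *: (t * x * t) by [].
  by rewrite /GRing.comm [in RHS]xy yE mxZr mxZl mxZr mxZl !mulrA.
suff : GRing.comm t (x ^+ j + y ^+ j) /\ GRing.comm t (x ^+ j.+1 + y ^+ j.+1).
  by case.
elim: j => [|j [IH0 IH1]]; split=> //.
  by rewrite !expr0; apply: commrD; apply: commr1.
have -> : x ^+ j.+2 + y ^+ j.+2 =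
  (x + y) * (x ^+ j.+1 + y ^+ j.+1) - x * y * (x ^+ j + y ^+ j).
  have -> : x * y * (x ^+ j + y ^+ j) = y * x ^+ j.+1 + x * y ^+ j.+1.
    by rewrite mulrDr {1}xy -!mulrA -!exprS.
  rewrite (exprS x j.+1) (exprS y j.+1).
  move: (x ^+ j.+1) (y ^+ j.+1) => X Y.
  by rewrite mulrDr !mulrDl [x * Y + _]addrC addrACA addrK.
by apply: commrB; apply: commrM.
Qed.

Lemma comm_T_psum i j : (i < n)%N -> GRing.comm (T i) (jm_psum n j).
Proof.
move=> iln; rewrite /jm_psum -(big_mkord xpredT (fun k => jm k ^+ j)).
case: i iln => [|i] iln.
  apply: commr_sum => k _; apply: commrX.
  by case: k => [|k]; [exact: commr_refl|exact: comm_T_jm_below].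
have -> : \sum_(0 <= k < n) jm k ^+ j = \sum_(0 <= k < i) jm k ^+ j
    + (jm i ^+ j + jm i.+1 ^+ j) + \sum_(i.+2 <= k < n) jm k ^+ j.
  rewrite (@big_cat_nat _ _ _ i) /=; try lia.
  by rewrite (@big_ltn _ _ _ i) 1?(@big_ltn _ _ _ i.+1) ?addrA; try lia.
apply: commrD; first apply: commrD.
- rewrite big_nat; apply: commr_sum => k /andP[_ ki]; apply: commrX.
  exact: comm_T_jm_above.
- exact: comm_T_pair.
- rewrite big_nat; apply: commr_sum => k /andP[ki _]; apply: commrX.
  exact: comm_T_jm_below.
Qed.

(** The list may be longer than a list of eigenvalues: all that matters is that
    some polynomial with its roots in F kills A. *)
Definition split_ann (s : seq F) (A : 'M[F]_d) : Prop :=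
  \prod_(c <- s) (A - c%:M) = 0.

(** Since y - e c = (y - e x) + e (x - c), the product is divisible by y - e x
    up to a multiple of the product of the x - c, which is 0. *)
Lemma split_factor (e : F) (x y : 'M[F]_d) s :
  GRing.comm x y -> split_ann s x ->
  exists G, \prod_(c <- s) (y - (e * c)%:M) = (y - e *: x) * G.
Proof.
move=> xy; rewrite /split_ann.
suff [G EG] : exists G, \prod_(c <- s) (y - (e * c)%:M) =
    (y - e *: x) * G + e ^+ size s *: \prod_(c <- s) (x - c%:M).
  by move=> sx; exists G; rewrite EG sx scaler0 addr0.
elim: s => [|c s [G IH]].
  by exists 0; rewrite !big_nil mulr0 add0r scale1r.
rewrite !big_cons IH.
set P := \prod_(c0 <- s) _; set k := e ^+ size s.
exists ((y - (e * c)%:M) * G + k *: P).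
have cm : GRing.comm (y - (e * c)%:M) (y - e *: x).
  apply: commrB.
    by apply/commr_sym/commrB; [exact: commr_refl|exact: comm_scalar].
  apply/commZ/commr_sym/commrB => //; exact: comm_scalar.
rewrite mulrDr mulrA cm -mulrA mulrDr -addrA; congr (_ + _).
have -> : y - (e * c)%:M = (y - e *: x) + e *: (x - c%:M).
  by rewrite scalerBr addrA subrK scale_scalar_mx.
by rewrite mulrDl; congr (_ + _); rewrite mxZl mxZr scalerA /= exprS.
Qed.

Definition neighbours (s : seq F) : seq F :=
  s ++ [seq q * c | c <- s] ++ [seq q^-1 * c | c <- s].

(** Let P be the polynomial with root list s, so that P(x) = 0. Then
    P(y) tau = tau P(x) = 0, and composing once more with tau gives
    P(y) (y - q x) (y - q^-1 x) = 0. The two extra factors divide polynomials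
    in y alone, by [split_factor]; their roots are the neighbours q c and
    q^-1 c. *)
Lemma split_ann_jmS i s : (0 < i.+1 < n)%N ->
  split_ann s (jm i) -> split_ann (neighbours s) (jm i.+1).
Proof.
move=> iln; set x := jm i; set y := jm i.+1; set t := T i.+1 => sx.
have xy : GRing.comm x y by exact: comm_jm.
have ty : t * y = (q - 1) *: y + x * t by exact: T_jmS.
have yt : y * t = (q - 1) *: y + t * x by exact: jmS_T.
have [tau tauX tau2] := intertwiner q_neq0 xy (T_sqr iln) ty yt.
have PyTau : \prod_(c <- s) (y - c%:M) * tau = 0.
  suff <- : tau * \prod_(c <- s) (x - c%:M) = \prod_(c <- s) (y - c%:M) * tau.
    by rewrite sx mulr0.
  elim: s {sx} => [|c s IH]; first by rewrite !big_nil mulr1 mul1r.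
  rewrite !big_cons -mulrA -IH !mulrA; congr (_ * _).
  rewrite mulrBl mulrBr tauX; congr (_ - _); exact: comm_scalar.
have [G1 E1] := split_factor q xy sx.
have [G2 E2] := split_factor q^-1 xy sx.
rewrite /split_ann !big_cat !big_map /=.
set P := \prod_(c <- s) (y - c%:M) in PyTau *.
set A := \prod_(c <- s) (y - (q * c)%:M) in E1 *.
have yA : GRing.comm (y - q^-1 *: x) A.
  apply: commr_prod => c _; apply: commr_sym; apply: commrB.
    apply/commr_sym/commrB; [exact: commr_refl | exact: comm_scalar].
  by apply/commZ/commr_sym/commrB => //; exact: comm_scalar.
have yy : GRing.comm (y - q *: x) (y - q^-1 *: x).
  have cy e : GRing.comm y (y - e *: x).
    by apply: commrB; [exact: commr_refl | apply/commZ/commr_sym].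
  have cx e : GRing.comm x (y - e *: x).
    by apply: commrB => //; apply/commZ/commr_refl.
  by apply/commr_sym/commrB; [|apply: commZ]; apply: commr_sym.
have Pyy : P * ((y - q *: x) * (y - q^-1 *: x)) = 0.
  apply: (scalerI (_ : - q != 0)); first by rewrite oppr_eq0.
  by rewrite scaler0 -mxZr -tau2 mulrA PyTau mul0r.
rewrite E2 (mulrA A) -yA E1 !mulrA -[P * _ * _]mulrA -yy Pyy !mul0r.
by [].
Qed.

Lemma split_ann_jm (good : F -> Prop) s :
  (forall c, good c -> good (q * c)) -> (forall c, good c -> good (q^-1 * c)) ->
  {in s, forall c, good c} -> ((0 < n)%N -> split_ann s (T 0%N)) ->
  forall k, (k < n)%N ->
  exists2 s', {in s', forall c, good c} & split_ann s' (jm k).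
Proof.
move=> goodq goodV goods annT; elim=> [|k IHk] kn; first by exists s => //; exact: annT.
have [s' goods' anns'] := IHk (ltnW kn).
exists (neighbours s'); last exact: split_ann_jmS.
move=> c; rewrite !mem_cat => /or3P[|/mapP[c' cs ->]|/mapP[c' cs ->]].
- exact: goods'.
- exact/goodq/goods'.
- exact/goodV/goods'.
Qed.

(** Apply the factors A - c to v one after the other: the last vector before 0
    is an eigenvector. It is the image of v under an operator B that commutes
    with whatever commutes with A, so common eigenvectors of such operators
    stay common eigenvectors. *)
Lemma split_eigenvector s (A : 'M[F]_d) (v : 'rV[F]_d) :
  v != 0 -> v *m \prod_(c <- s) (A - c%:M) = 0 ->
  exists2 c, c \in s & exists B : 'M[F]_d,
    [/\ forall C, GRing.comm C A -> GRing.comm C B, v *m B != 0 &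
        v *m B *m A = c *: (v *m B)].
Proof.
elim: s v => [|c s IHs] v v_neq0.
  by rewrite big_nil mulmx1 => v0; rewrite v0 eqxx in v_neq0.
rewrite big_cons -mulmxE mulmxA => vAs.
have [vA0|vA_neq0] := eqVneq (v *m (A - c%:M)) 0.
  exists c; first exact: mem_head.
  exists 1; rewrite mulmx1; split=> // [C _|]; first exact: commr1.
  by apply/eqP; rewrite -subr_eq0 -mul_mx_scalar -mulmxBr vA0.
have [c' c's [B [commB vAB eigB]]] := IHs _ vA_neq0 vAs.
exists c'; first by rewrite inE c's orbT.
exists ((A - c%:M) *m B); split=> [C CA||]; rewrite ?mulmxA //.
by apply: commrM; [apply: commrB => //; exact: comm_scalar | exact: commB].
Qed.

(** The predicate good is any property of scalars that is inherited by
    neighbours. In the application it is integrality at Phi; working with it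
    avoids an algebraic closure of K(y). *)
Lemma jm_joint_eigenvector (good : F -> Prop) s :
  (forall c, good c -> good (q * c)) -> (forall c, good c -> good (q^-1 * c)) ->
  {in s, forall c, good c} -> ((0 < n)%N -> split_ann s (T 0%N)) ->
  (0 < d)%N ->
  exists2 c : 'I_n -> F, (forall k, good (c k)) &
  exists2 v : 'rV[F]_d, v != 0 & forall k : 'I_n, v *m jm k = c k *: v.
Proof.
move=> goodq goodV goods annT d_gt0.
have eigen m : (m <= n)%N -> exists2 v : 'rV[F]_d, v != 0 &
    forall k, (k < m)%N -> exists2 c, good c & v *m jm k = c *: v.
  elim: m => [_|m IHm mn].
    exists (const_mx 1) => //.
    by apply/eqP => /rowP/(_ (Ordinal d_gt0))/eqP; rewrite !mxE oner_eq0.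
  have [v v_neq0 eigv] := IHm (ltnW mn).
  have [s' goods' anns'] := split_ann_jm goodq goodV goods annT mn.
  have [|c cs' [B [commB vB_neq0 eigB]]] := @split_eigenvector s' (jm m) v v_neq0.
    by rewrite [X in _ *m X]anns' mulmx0.
  exists (v *m B) => // k; rewrite ltnS leq_eqVlt => /orP[/eqP->|/eigv[ck]].
    by exists c; [exact: goods'|].
  move=> good_ck vk; exists ck => //.
  have /esym BC := commB _ (comm_jm k m).
  by rewrite -mulmxA [B *m _]BC -mulmxE mulmxA vk -scalemxAl.
have [v v_neq0 eigv] := eigen n (leqnn n).
have [c goodc eigc] := fin_all_exists2 (fun k : 'I_n => eigv k (ltn_ord k)).
by exists c => //; exists v.
Qed.

Lemma eigenvector_psum (c : 'I_n -> F) (v : 'rV[F]_d) j :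
  (forall k : 'I_n, v *m jm k = c k *: v) ->
  v *m jm_psum n j = (\sum_k c k ^+ j) *: v.
Proof.
move=> eigv; rewrite mulmx_sumr scaler_suml; apply: eq_bigr => k _.
elim: j => [|j IHj]; first by rewrite mulmx1 scale1r.
by rewrite exprS -mulmxE mulmxA eigv -scalemxAl IHj scalerA exprS.
Qed.

End JucysMurphy.

(** * Specialisation of fractions; power sums and multisets *)

Section Specialisation.
Variables (D : idomainType) (F : fieldType) (s : {rmorphism D -> F}).
Implicit Types (x y : {fraction D}) (z w : F).

(** The extension of s to the localisation of D at its kernel, as a relation:
    s is only partially defined on the fraction field. It covers both the
    specialisation of the generic parameters and the residue map O -> K(eta). *)
Definition spz x z : Prop :=
  exists p g, [/\ s g != 0, x = p%:F / g%:F & z = s p / s g].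

Lemma spz_den g : s g != 0 -> g%:F != 0.
Proof. by apply: contraNneq => /eqP; rewrite tofrac_eq0 => /eqP->; rewrite rmorph0. Qed.

Lemma spz_inj x z w : spz x z -> spz x w -> z = w.
Proof.
move=> [p [g [sg -> ->]]] [p' [g' [sg' /eqP E ->]]].
have := E; rewrite eqr_div ?spz_den // -!tofracM tofrac_eq => /eqP pg.
by apply/eqP; rewrite eqr_div // -!rmorphM pg.
Qed.

Lemma spz_tofrac p : spz p%:F (s p).
Proof. by exists p, 1; rewrite !rmorph1 !divr1 oner_neq0. Qed.

Lemma spz0 : spz 0 0.
Proof. by have := spz_tofrac 0; rewrite !rmorph0. Qed.

Lemma spz1 : spz 1 1.
Proof. by have := spz_tofrac 1; rewrite !rmorph1. Qed.

Lemma spzD x y z w : spz x z -> spz y w -> spz (x + y) (z + w).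
Proof.
move=> [p [g [sg -> ->]]] [p' [g' [sg' -> ->]]].
exists (p * g' + p' * g), (g * g').
rewrite rmorphM mulf_neq0 // !addf_div ?spz_den //.
by split; rewrite // !(rmorphM, rmorphD).
Qed.

Lemma spzN x z : spz x z -> spz (- x) (- z).
Proof.
by move=> [p [g [sg -> ->]]]; exists (- p), g; rewrite !rmorphN !mulNr.
Qed.

Lemma spzM x y z w : spz x z -> spz y w -> spz (x * y) (z * w).
Proof.
move=> [p [g [sg -> ->]]] [p' [g' [sg' -> ->]]].
by exists (p * p'), (g * g'); rewrite !rmorphM mulf_neq0 // !mulf_div.
Qed.

Lemma spzV x z : z != 0 -> spz x z -> spz x^-1 z^-1.
Proof.
move=> z0 [p [g [sg -> zE]]]; exists g, p; move: z0; rewrite zE !invf_div.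
by rewrite mulf_eq0 negb_or => /andP[].
Qed.

Lemma spzX x z k : spz x z -> spz (x ^+ k) (z ^+ k).
Proof.
move=> xz; elim: k => [|k IH]; first exact: spz1.
by rewrite !exprS; apply: spzM.
Qed.

Lemma spzXz x z (k : int) : z != 0 -> spz x z -> spz (x ^ k) (z ^ k).
Proof.
move=> z0 xz; case: k => k; first exact: spzX.
by apply: (@spzV (x ^+ k.+1) (z ^+ k.+1)); [rewrite expf_neq0 | apply: spzX].
Qed.

Lemma spz_sum (I : Type) (r : seq I) (P : pred I) (X : I -> {fraction D}) Z :
  (forall i, P i -> spz (X i) (Z i)) ->
  spz (\sum_(i <- r | P i) X i) (\sum_(i <- r | P i) Z i).
Proof.
move=> XZ; elim/big_rec2: _ => [|i z x Pi xz]; first exact: spz0.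
by apply: spzD => //; apply: XZ.
Qed.

Lemma spz_nat k : spz k%:R k%:R.
Proof. by have := spz_tofrac k%:R; rewrite !rmorph_nat. Qed.

Definition spz_mx m k (A : 'M[{fraction D}]_(m, k)) (B : 'M[F]_(m, k)) : Prop :=
  forall i j, spz (A i j) (B i j).

Lemma spz_mx_mul m k h (A : 'M_(m, k)) (B : 'M_(k, h)) A' B' :
  spz_mx A A' -> spz_mx B B' -> spz_mx (A *m B) (A' *m B').
Proof.
by move=> AA BB i j; rewrite !mxE; apply: spz_sum => l _; apply: spzM.
Qed.

Variables (d : nat) (x : {fraction D}) (z : F).
Hypotheses (z_neq0 : z != 0) (xz : spz x z).
Variables (T : nat -> 'M[{fraction D}]_d) (T' : nat -> 'M[F]_d).
Hypothesis TT' : forall i, spz_mx (T i) (T' i).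

Lemma spz_jm k : spz_mx (jm x T k) (jm z T' k).
Proof.
elim: k => [|k IHk] //= i j; rewrite mxE [X in spz _ X]mxE.
apply: spzM; first exact: spzV.
by do 2!apply: spz_mx_mul => // {}i {}j.
Qed.

Lemma spz_jm_psum n j : spz_mx (jm_psum x T n j) (jm_psum z T' n j).
Proof.
rewrite /jm_psum => a b; rewrite !summxE; apply: spz_sum => k _.
elim: j a b => [|j IHj] a b.
  by rewrite !mxE; case: eqP => _; [exact: spz1|exact: spz0].
by rewrite !exprS; apply: spz_mx_mul => //; apply: spz_jm.
Qed.

End Specialisation.

(** By linearity the sums of p(x) agree for every polynomial p; a polynomial
    vanishing at all entries except c then compares the multiplicities
    of c. *)
Lemma psum_perm_eq (F : fieldType) (s t : seq F) :
  (forall k, (k%:R == 0 :> F) = (k == 0)%N) ->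
  (forall j, \sum_(x <- s) x ^+ j = \sum_(x <- t) x ^+ j) -> perm_eq s t.
Proof.
move=> char0 psum.
have polys (p : {poly F}) : \sum_(x <- s) p.[x] = \sum_(x <- t) p.[x].
  under eq_bigr do rewrite horner_coef.
  under [RHS]eq_bigr do rewrite horner_coef.
  rewrite exchange_big [RHS]exchange_big; apply: eq_bigr => i _.
  by rewrite -!mulr_sumr psum.
apply/allP => c _ /=.
pose r := [seq x <- undup (s ++ t) | x != c].
pose p := \prod_(x <- r) ('X - x%:P).
have pc : p.[c] != 0.
  rewrite horner_prod prodf_seq_neq0; apply/allP => x.
  by rewrite mem_filter => /andP[xc _]; rewrite hornerXsubC subr_eq0 eq_sym.
have count_p u : {subset u <= s ++ t} -> \sum_(x <- u) p.[x] = p.[c] *+ count_mem c u.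
  elim: u => [|x u IHu] ust; first by rewrite big_nil.
  rewrite big_cons IHu => [|y yu]; last by apply: ust; rewrite inE yu orbT.
  rewrite /= mulrnDr; congr (_ + _); case: eqP => [->//|/eqP xc].
  apply/eqP; rewrite -/(root p x) root_prod_XsubC mem_filter xc mem_undup.
  by apply: ust; exact: mem_head.
have := polys p; rewrite !count_p => [/eqP|x|x]; last 2 first.
- by rewrite mem_cat => ->; rewrite orbT.
- by rewrite mem_cat => ->.
rewrite -[_ *+ count_mem c s]mulr_natl -[_ *+ count_mem c t]mulr_natl.
rewrite (inj_eq (mulIf pc)); move: (count_mem c s) (count_mem c t) => a b.
wlog ab : a b / (a <= b)%N.
  by move=> H; case: (leqP a b) => [/H //|/ltnW/H{}H]; rewrite eq_sym => /H/eqP->.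
by rewrite eq_sym -subr_eq0 -natrB // char0 subn_eq0 eqn_leq ab.
Qed.

(** * Scalars by which power sums act on modules *)

Section Compatible.
Variables (F : fieldType) (d d' : nat) (W : 'M[F]_d) (P : 'M[F]_(d, d')).

(** X stabilises the row space of W, and P maps the action of X on it to that
    of X'. With W = 1 this covers isomorphisms and changes of lattice basis;
    with W a submodule it covers the projection to a subquotient. The relation
    passes from the generators to all polynomials in them. *)
Definition compatible (X : 'M[F]_d) (X' : 'M[F]_d') : Prop :=
  (W *m X <= W)%MS /\ W *m X *m P = W *m P *m X'.

Lemma compatible0 : compatible 0 0.
Proof. by split; rewrite !mulmx0 ?sub0mx ?mul0mx. Qed.

Lemma compatible1 : compatible 1 1.
Proof. by split; rewrite ?mulmx1. Qed.

Lemma compatibleD X Y X' Y' :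
  compatible X X' -> compatible Y Y' -> compatible (X + Y) (X' + Y').
Proof.
move=> [sX eX] [sY eY]; split; first by rewrite mulmxDr addmx_sub.
by rewrite mulmxDr mulmxDl eX eY -mulmxDr.
Qed.

Lemma compatibleZ c X X' : compatible X X' -> compatible (c *: X) (c *: X').
Proof.
move=> [sX eX]; split; first by rewrite -scalemxAr scalemx_sub.
by rewrite -!scalemxAr -scalemxAl eX.
Qed.

Lemma compatibleM X Y X' Y' :
  compatible X X' -> compatible Y Y' -> compatible (X * Y) (X' * Y').
Proof.
move=> [sX eX] [sY eY]; rewrite -!mulmxE.
have /submxP[Z eZ] := sX; split.
  by rewrite mulmxA eZ -mulmxA (submx_trans (submxMl _ _)).
by rewrite mulmxA eZ -!mulmxA (mulmxA W) eY !mulmxA -eZ eX.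
Qed.

Lemma compatible_psum q (T : nat -> 'M[F]_d) (T' : nat -> 'M[F]_d') n j :
  (forall i, compatible (T i) (T' i)) ->
  compatible (jm_psum q T n j) (jm_psum q T' n j).
Proof.
move=> TT'; have cjm k : compatible (jm q T k) (jm q T' k).
  elim: k => //= k IHk; apply: compatibleZ; apply: compatibleM => //.
  exact: compatibleM.
rewrite /jm_psum; elim/big_rec2: _ => [|k A B _ AB]; first exact: compatible0.
apply: compatibleD => //; elim: j {AB} => [|j IHj]; first exact: compatible1.
by rewrite !exprS; apply: compatibleM.
Qed.

End Compatible.

Section Modules.
Variables (F : fieldType) (n l : nat) (Q : 'I_l -> F) (q : F).
Implicit Types M N V : AK_module n Q q.

Definition psum M (j : nat) : 'M[F]_(dimM M) := jm_psum q (gen M) n j.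

Lemma JM_jm M k : JM M k = jm q (gen M) k.
Proof. by elim: k => //= k ->. Qed.

Lemma gen_ord M (i : 'I_n) : gen M i = act M i.
Proof. by rewrite /gen valK. Qed.

Lemma gen_out M k : (n <= k)%N -> gen M k = 0.
Proof. by move=> nk; rewrite /gen insubN // -leqNgt. Qed.

Lemma gen_quad M i : (0 < i < n)%N -> (gen M i - q%:M) * (gen M i + 1) = 0.
Proof.
case/andP => i0 ilt; have [_ quad _ _ _] := actP M.
by have := quad (Ordinal ilt) i0; rewrite -gen_ord.
Qed.

Lemma gen_braid0 M :
  gen M 0 * gen M 1 * gen M 0 * gen M 1 = gen M 1 * gen M 0 * gen M 1 * gen M 0.
Proof.
case: (ltnP 1 n) => [n1|n1]; last by rewrite (gen_out _ n1) !(mulr0, mul0r).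
have [_ _ braid0 _ _] := actP M.
have := braid0 (Ordinal (ltnW n1)) (Ordinal n1) erefl erefl.
by rewrite -!gen_ord.
Qed.

Lemma gen_braid M i : (0 < i)%N ->
  gen M i * gen M i.+1 * gen M i = gen M i.+1 * gen M i * gen M i.+1.
Proof.
move=> i0; case: (ltnP i.+1 n) => [n1|n1]; last by rewrite (gen_out _ n1) !(mulr0, mul0r).
have [_ _ _ braid _] := actP M.
have := braid (Ordinal (ltnW n1)) (Ordinal n1) i0 erefl.
by rewrite -!gen_ord.
Qed.

Lemma gen_far M i j : (i.+1 < j)%N -> gen M i * gen M j = gen M j * gen M i.
Proof.
move=> ij; case: (ltnP j n) => [jn|jn]; last by rewrite (gen_out _ jn) !(mulr0, mul0r).
have [_ _ _ _ far] := actP M.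
have := far (Ordinal (ltn_trans (ltnW ij) jn)) (Ordinal jn) ij.
by rewrite -!gen_ord.
Qed.

Hypothesis q_neq0 : q != 0.

Lemma psum_central M (i : 'I_n) j : GRing.comm (act M i) (psum M j).
Proof.
rewrite -gen_ord; apply: comm_T_psum; rewrite ?ltn_ord //.
- exact: gen_quad.
- exact: gen_braid0.
- exact: gen_braid.
- exact: gen_far.
Qed.

(** The kernel of p_j - b, for b the eigenvalue of p_j on a common eigenvector
    of the L_k, is a non-zero submodule. The list c of eigenvalues does not
    depend on j. *)
Lemma simple_psum_scalar M (good : F -> Prop) :
  (forall a, good (Q a)) ->
  (forall c, good c -> good (q * c)) -> (forall c, good c -> good (q^-1 * c)) ->
  simple M ->
  exists2 c : 'I_n -> F, (forall k, good (c k)) &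
    forall j, psum M j = (\sum_k c k ^+ j)%:M.
Proof.
move=> goodQ goodq goodV [d_gt0 simpleM].
have annT : (0 < n)%N -> split_ann [seq Q a | a <- index_enum 'I_l] (gen M 0).
  move=> n0; rewrite /split_ann big_map.
  have [annT _ _ _ _] := actP M.
  by have := annT (Ordinal n0) erefl; rewrite -gen_ord.
have goods : {in [seq Q a | a <- index_enum 'I_l], forall c, good c}.
  by move=> _ /mapP[a _ ->].
have [c goodc [v v_neq0 eigv]] := jm_joint_eigenvector q_neq0 (@gen_quad M)
  (gen_braid0 M) (@gen_braid M) (@gen_far M) goodq goodV goods annT d_gt0.
exists c => // j; set b := \sum_k _.
have stableK : stable (kermx (psum M j - b%:M)).
  move=> i; apply/sub_kermxP; rewrite -mulmxA.
  have cZ : act M i *m (psum M j - b%:M) = (psum M j - b%:M) *m act M i.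
    by apply: commrB; [exact: psum_central | exact: comm_scalar].
  by rewrite cZ mulmxA mulmx_ker mul0mx.
have vK : (v <= kermx (psum M j - b%:M))%MS.
  apply/sub_kermxP; rewrite mulmxBr (eigenvector_psum _ eigv) mul_mx_scalar.
  exact: subrr.
have [K0|/row_fullP[B BK]] := simpleM _ stableK.
  have KE : kermx (psum M j - b%:M) = 0 by apply/eqP; rewrite -mxrank_eq0 K0.
  by move: vK v_neq0; rewrite KE submx0 => ->.
apply/eqP; rewrite -subr_eq0 -[_ - _]mul1mx -BK -mulmxA mulmx_ker mulmx0.
by [].
Qed.

Lemma iso_psum M N j : iso M N ->
  exists2 P : 'M_(dimM M, dimM N), row_free P /\ row_full P &
     psum M j *m P = P *m psum N j.
Proof.
move=> [P [freeP fullP PE]]; exists P => //.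
have [] := @compatible_psum _ _ _ 1%:M P q (gen M) (gen N) n j.
  move=> i; split; first exact: submx1.
  rewrite !mul1mx; case: (ltnP i n) => [ilt|igt]; last first.
    by rewrite !gen_out // mul0mx mulmx0.
  by rewrite !(gen_ord _ (Ordinal ilt)).
by rewrite !mul1mx.
Qed.

Lemma iso_psum_scalar M N j b : iso M N -> psum M j = b%:M -> psum N j = b%:M.
Proof.
move=> /(@iso_psum _ _ j)[P [freeP fullP]] PE Mb.
have /row_fullP[B BP] := fullP.
move: PE; rewrite Mb mul_scalar_mx -mul_mx_scalar => /(congr1 (mulmx B)).
by rewrite !mulmxA BP !mul1mx => ->.
Qed.

Lemma subquotient_psum_scalar M N U W j b :
  stable W -> @subquotient _ _ _ _ _ M U W N -> psum M j = b%:M -> psum N j = b%:M.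
Proof.
move=> stableW [_ [A [fullWA _ AE]]] Mb.
have [] := @compatible_psum _ _ _ W A q (gen M) (gen N) n j.
  move=> i; case: (ltnP i n) => [ilt|igt]; last first.
    by rewrite !gen_out //; exact: compatible0.
  rewrite !(gen_ord _ (Ordinal ilt)); split; [exact: stableW|exact: AE].
move=> _; rewrite -/(psum M j) -/(psum N j) Mb mul_mx_scalar -scalemxAl -mul_mx_scalar.
have /row_fullP[B] := fullWA; move: (W *m A) => X BX /(congr1 (mulmx B)).
by rewrite !mulmxA BX !mul1mx => ->.
Qed.

Lemma composition_factor_psum_scalar M N m j b :
  composition_multiplicity M N m -> m != 0%N ->
  psum M j = b%:M -> psum N j = b%:M.
Proof.
move=> [k [U [S [[_ _ stableU factor] ->]]]].
move=> m_neq0 Mb.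
have [i /boolp.asboolP isoSN|no_iso] := pickP (fun i => boolp.asbool (iso (S i) N));
  last by rewrite (eq_card0 no_iso) in m_neq0.
apply: iso_psum_scalar isoSN _.
by have [_ /subquotient_psum_scalar] := factor i; apply=> //; exact: stableU.
Qed.

End Modules.

(** The word is the same for all modules over all fields: this is what lets the
    trace of a power of L_k be compared before and after specialisation. *)
Lemma JM_power_word (n k j : nat) : (k < n)%N ->
  exists (e : nat) (w : seq 'I_n), forall (F : fieldType) (l : nat)
    (Q : 'I_l -> F) (q : F) (M : AK_module n Q q),
    JM M k ^+ j = q^-1 ^+ e *: \prod_(i <- w) act M i.
Proof.
move=> kn; have [e [w JMw]] : exists (e : nat) (w : seq 'I_n),
    forall (F : fieldType) (l : nat) (Q : 'I_l -> F) (q : F)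
    (M : AK_module n Q q), JM M k = q^-1 ^+ e *: \prod_(i <- w) act M i.
  elim: k kn => [|k IHk] kn.
    exists 0%N, [:: Ordinal kn] => F l Q q M.
    by rewrite big_seq1 scale1r -gen_ord.
  have [e [w JMw]] := IHk (ltnW kn).
  exists e.+1, (Ordinal kn :: rcons w (Ordinal kn)) => F l Q q M /=.
  rewrite JMw big_cons big_rcons -!gen_ord /= exprS -scalerA; congr (_ *: _).
  by rewrite -scalemxAr -scalemxAl mulmxE !mulrA.
elim: j => [|j [e' [w' IHj]]].
  by exists 0%N, [::] => F l Q q M; rewrite big_nil scale1r.
exists (e + e')%N, (w ++ w') => F l Q q M.
by rewrite exprS IHj JMw big_cat mxZl mxZr scalerA -exprD.
Qed.

(** * Residues of nodes and seminormal bases *)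

Definition residues (F : fieldType) (l : nat) (Q : 'I_l -> F) (q : F)
    (lam : 'I_l -> seq nat) : seq F :=
  [seq q ^ (x.2.2%:Z - x.2.1%:Z) * Q x.1 |
     x <- flatten [seq flatten [seq [seq (a, (i, j)) | j <- iota 0 (nth 0%N (lam a) i)]
                               | i <- iota 0 (size (lam a))]
                  | a <- index_enum 'I_l]].

Lemma big_residues (F : fieldType) (l : nat) (Q : 'I_l -> F) (q : F)
    (lam : 'I_l -> seq nat) (V : nmodType) (f : F -> V) :
  \sum_(x <- residues Q q lam) f x =
  \sum_a \sum_(i < size (lam a)) \sum_(j < nth 0%N (lam a) i)
     f (q ^ (j%:Z - i%:Z) * Q a).
Proof.
rewrite /residues big_map big_flatten big_map; apply: eq_bigr => a _.
rewrite big_flatten big_map -[size _ in LHS]subn0 -/(index_iota 0 _) big_mkord.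
apply: eq_bigr => i _.
by rewrite big_map -[X in iota 0 X]subn0 -/(index_iota 0 _) big_mkord.
Qed.

Section Diagram.
Variables (n l : nat) (lam : 'I_l -> seq nat).
Hypothesis lamP : is_multipartition n lam.

Lemma sumn_nth (s : seq nat) i : (nth 0 s i <= sumn s)%N.
Proof.
elim: s i => [|x s IHs] [|i] //=; first by rewrite leq_addr.
by rewrite (leq_trans (IHs i)) ?leq_addl.
Qed.

Lemma size_sumn (s : seq nat) : 0%N \notin s -> (size s <= sumn s)%N.
Proof.
elim: s => //= x s IHs; rewrite inE negb_or eq_sym -lt0n => /andP[x0 /IHs].
lia.
Qed.

Lemma sumn_lam a : (sumn (lam a) <= n)%N.
Proof. by have [_ <-] := lamP; rewrite (bigD1 a) //= leq_addr. Qed.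

Lemma sum_ord_lt (V : nmodType) (m p : nat) (f : nat -> V) : (p <= m)%N ->
  \sum_(j < m | (j < p)%N) f j = \sum_(j < p) f j.
Proof. by move=> pm; rewrite (big_ord_widen m f pm). Qed.

Lemma sum_diagram (V : nmodType) (f : 'I_l -> nat -> nat -> V) :
  \sum_(x : node n l | in_diagram (lam x.1.1) x.1.2 x.2) f x.1.1 x.1.2 x.2 =
  \sum_a \sum_(i < size (lam a)) \sum_(j < nth 0%N (lam a) i) f a i.+1 j.+1.
Proof.
have [partP _] := lamP.
transitivity (\sum_(a < l) \sum_(i < n.+1)
    \sum_(j < n.+1 | in_diagram (lam a) i j) f a i j).
  by rewrite pair_big pair_big_dep.
apply: eq_bigr => a _.
have /andP[_ /size_sumn size_le] := partP a.
rewrite big_ord_recl big1 ?add0r; last by case.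
rewrite -(sum_ord_lt (fun i => \sum_(j < nth 0%N (lam a) i) f a i.+1 j.+1)
  (leq_trans size_le (sumn_lam a))).
have rowE i : \sum_(j < n.+1 | in_diagram (lam a) i.+1 j) f a i.+1 j =
    \sum_(j < nth 0%N (lam a) i) f a i.+1 j.+1.
  rewrite big_mkcond big_ord_recl /= add0r -big_mkcond /=.
  exact: (sum_ord_lt (f a i.+1 \o S) (leq_trans (sumn_nth _ _) (sumn_lam a))).
rewrite [RHS]big_mkcond; apply: eq_bigr => i _.
rewrite (rowE i); case: ltnP => // igt.
by rewrite nth_default // big_ord0.
Qed.

Lemma sum_parts : (\sum_a \sum_(i < size (lam a)) \sum_(j < nth 0 (lam a) i) 1 = n)%N.
Proof.
have [_ sum_n] := lamP; rewrite -[RHS]sum_n; apply: eq_bigr => a _.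
rewrite sumnE (big_nth 0%N) big_mkord; apply: eq_bigr => i _.
by rewrite sum1_card card_ord.
Qed.

(** A standard tableau is an injective filling of n nodes by n numbers, so it
    enumerates the nodes. *)
Lemma std_tableau_sum (t : std_tableau n lam) (V : nmodType)
    (f : 'I_l -> nat -> nat -> V) :
  \sum_(k < n) f (val t k).1.1 (val t k).1.2 (val t k).2 =
  \sum_a \sum_(i < size (lam a)) \sum_(j < nth 0%N (lam a) i) f a i.+1 j.+1.
Proof.
have /and4P[/injectiveP t_inj /forallP t_diag _ _] := valP t.
rewrite -sum_diagram.
pose D := [set x : node n l | in_diagram (lam x.1.1) x.1.2 x.2].
have tD : [set val t k | k in 'I_n] = D.
  apply/eqP; rewrite eqEcard card_imset // card_ord; apply/andP; split.
    by apply/subsetP => _ /imsetP[k _ ->]; rewrite inE.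
  rewrite -sum1_card (eq_bigl _ _ (fun x => in_set _ x)).
  by rewrite (sum_diagram (fun _ _ _ => 1%N)) sum_parts.
rewrite (eq_bigl (fun x => x \in D)) => [|x]; last by rewrite inE.
by rewrite -tD big_imset //=; move=> k k' _ _; apply: t_inj.
Qed.

End Diagram.

Section Seminormal.
Variables (F : fieldType) (n l : nat) (Q : 'I_l -> F) (q : F).
Variable lam : 'I_l -> seq nat.
Hypothesis lamP : is_multipartition n lam.

(** Every vector of the basis has the same eigenvalue under p_j, as the contents
    along any standard tableau are those of all nodes. *)
Lemma seminormal_psum (M : AK_module n Q q) j : has_seminormal_basis lam M ->
  psum M j = (\sum_(x <- residues Q q lam) x ^+ j)%:M.
Proof.
move=> [b [/andP[/eqP span_b _] eigb]].
apply/row_matrixP => i; rewrite !rowE; move: (delta_mx _ _) => v.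
have : v \in <<codom b>>%VS by rewrite span_b memvf.
move/coord_span->; rewrite !mulmx_suml; apply: eq_bigr => k _.
rewrite -!scalemxAl; congr (_ *: _).
have /codomP[t ->] : (codom_tuple b)`_k \in codom b.
  by rewrite mem_nth // size_tuple.
rewrite (@eigenvector_psum _ _ _ _ _ (fun k => content Q q (val t k))) => [|k'].
  rewrite mul_mx_scalar big_residues; congr (_ *: _).
  rewrite (std_tableau_sum lamP t (fun a i j' => (q ^ (j'%:Z - i%:Z) * Q a) ^+ j)).
  apply: eq_bigr => a _; apply: eq_bigr => i' _; apply: eq_bigr => j' _.
  by congr ((q ^ _ * _) ^+ _); lia.
by rewrite -JM_jm eigb.
Qed.

End Seminormal.

(** * A block determines the multiset of residues *)

Lemma scalar_mx_inj_pos (F : fieldType) d (a b : F) :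
  (0 < d)%N -> a%:M = b%:M :> 'M_d -> a = b.
Proof.
by move=> d0 /matrixP/(_ (Ordinal d0) (Ordinal d0)); rewrite !mxE eqxx.
Qed.

Lemma cycl_Q_neq0 (F : fieldType) l (rs : 'I_l -> int) (z y : F) a :
  z != 0 -> y != 0 -> cycl_Q rs z y a != 0.
Proof. by move=> z0 y0; rewrite mulf_neq0 ?expf_neq0 ?expfz_neq0. Qed.

Lemma cycl_q_neq0 (F : fieldType) (r : int) (y : F) : y != 0 -> cycl_q r y != 0.
Proof. exact: expfz_neq0. Qed.

Section Labelled.
Variables (F : fieldType) (n l : nat) (Q : 'I_l -> F) (q : F).
Hypothesis char0 : forall k, (k%:R == 0 :> F) = (k == 0)%N.
Hypotheses (Q_neq0 : forall a, Q a != 0) (q_neq0 : q != 0).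

Definition spec_val (i : 'I_l.+1) : F :=
  if unlift ord_max i is Some a then Q a else q.

Definition spec_morph : {rmorphism {mpoly int[l.+1]} -> F} :=
  mmap (intr : int -> F) spec_val.

Lemma specialises_spz x z : specialises_to Q q x z -> spz spec_morph x z.
Proof.
move=> [p [m [-> ->]]]; exists p, 'X_[m]; split=> //.
rewrite /= mmapX /mmap1; apply/prodf_neq0 => i _; rewrite expf_neq0 //.
by rewrite /spec_val; case: unlift.
Qed.

Lemma spz_gen_Q a : spz spec_morph (gen_Q a) (Q a).
Proof.
have := spz_tofrac spec_morph 'X_(widen_ord (leqnSn l) a).
rewrite /= mmapX mmap1U /spec_val.
have {2}-> : widen_ord (leqnSn l) a = lift ord_max a.
  by apply: val_inj; rewrite /= /bump leqNgt ltn_ord.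
by rewrite liftK.
Qed.

Lemma spz_gen_q : spz spec_morph (gen_q l) q.
Proof.
have := spz_tofrac spec_morph 'X_(ord_max).
by rewrite /= mmapX mmap1U /spec_val unlift_none.
Qed.

Lemma spz_residue_psum lam j :
  spz spec_morph (\sum_(x <- residues (@gen_Q l) (gen_q l) lam) x ^+ j)
    (\sum_(x <- residues Q q lam) x ^+ j).
Proof.
rewrite !big_residues; do 3!apply: spz_sum => ? _.
apply/spzX/spzM; last exact: spz_gen_Q.
by apply: spzXz => //; exact: spz_gen_q.
Qed.

Lemma trace_psum (V : AK_module n Q q) (W : gen_module n l) j :
  (forall w, specialises_to Q q (word_trace W w) (word_trace V w)) ->
  spz spec_morph (\tr (psum W j)) (\tr (psum V j)).
Proof.
move=> tr_spec; rewrite /psum /jm_psum !raddf_sum; apply: spz_sum => k _ /=.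
have [e [w powE]] := JM_power_word j (ltn_ord k).
rewrite -!JM_jm !powE !mxtraceZ; apply: spzM; last exact/specialises_spz/tr_spec.
by apply/spzX/spzV => //; exact: spz_gen_q.
Qed.

(** The trace of p_j is dim V times its scalar, on both sides of the
    specialisation, and the dimensions agree as traces of the empty word. *)
Lemma labelled_psum (V : AK_module n Q q) lam j c :
  is_multipartition n lam -> is_simple_labelled lam V -> psum V j = c%:M ->
  c = \sum_(x <- residues Q q lam) x ^+ j.
Proof.
move=> lamP [[dV _] [W [_ seminormalW] tr_spec]] Vc.
have := tr_spec [::]; rewrite /word_trace !big_nil => /specialises_spz.
rewrite !mxtrace1 => /(spz_inj (spz_nat _ _)) dimE.
have := trace_psum j tr_spec.
rewrite Vc (seminormal_psum lamP j seminormalW) !mxtrace_scalar.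
rewrite -[_ *+ dimM W]mulr_natr -[_ *+ dimM V]mulr_natr.
move/(spz_inj (spzM (spz_residue_psum lam j) (spz_nat _ _))); rewrite dimE.
by move/mulIf => -> //; rewrite char0 -lt0n.
Qed.

End Labelled.

Section Block.
Variables (K L : fieldType) (iota : {rmorphism K -> L}) (eta : L).
Variables (Phi : {poly K}) (zeta : K).
Variables (n l : nat) (rs : 'I_l -> int) (r : int).
Hypothesis char0 : forall k, (k%:R == 0 :> K) = (k == 0)%N.
Hypotheses (eta_neq0 : eta != 0) (zeta_neq0 : zeta != 0).
Hypothesis PhiP : is_min_poly iota eta Phi.

Definition ev_eta : {rmorphism {poly K} -> adj_field iota eta Phi} :=
  subfx_eval iota eta Phi.

Local Notation y := (ratX K).
Local Notation etaK := (adj_root iota eta Phi).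
Local Notation zetaK := (adjC iota eta Phi zeta).

Lemma ev_etaE p : (map_poly (adjC iota eta Phi) p).[etaK] = ev_eta p.
Proof.
elim/poly_ind: p => [|p c IH]; first by rewrite map_poly0 horner0 rmorph0.
by rewrite rmorphD rmorphM /= map_polyX map_polyC !hornerE IH rmorphD rmorphM.
Qed.

Lemma ev_eta_eq0 p : (ev_eta p == 0) = root (map_poly iota p) eta.
Proof.
have [/monic_neq0 Phi0 Phi_root _] := PhiP.
by rewrite -(fmorph_eq0 (@subfx_inj _ _ iota eta Phi)) /= subfx_inj_eval.
Qed.

Lemma etaK_neq0 : etaK != 0.
Proof. by rewrite [_ == 0]ev_eta_eq0 map_polyX rootX. Qed.

Lemma zetaK_neq0 : zetaK != 0.
Proof. by rewrite fmorph_eq0. Qed.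

Lemma spz_y : spz ev_eta y etaK.
Proof. exact: spz_tofrac. Qed.

Lemma spz_ratC c : spz ev_eta (ratC c) (adjC iota eta Phi c).
Proof. exact: spz_tofrac. Qed.

Lemma residue_spz x b : residue x b -> spz ev_eta x b.
Proof.
have theta_spz f b' : theta f b' -> spz ev_eta f b'.
  move=> [p [m [_ -> ->]]]; rewrite ev_etaE; apply: spzM; first exact: spz_tofrac.
  by apply/spzV; [rewrite expf_neq0 // etaK_neq0 | exact/spzX/spz_y].
move=> [f [g [b1 [b2 [/theta_spz f1 /theta_spz g2 b2_neq0 -> ->]]]]].
by apply/spzM/spzV.
Qed.

Local Notation phiQ := (cycl_Q rs (ratC zeta) y).
Local Notation phiq := (cycl_q r y).
Local Notation thetaQ := (cycl_Q rs zetaK etaK).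
Local Notation thetaq := (cycl_q r etaK).
Local Notation Ky_mod := (Ky_module zeta n rs r).

Lemma ratX_neq0 : y != 0.
Proof. by rewrite /ratX tofrac_eq0 polyX_eq0. Qed.

Lemma ratC_neq0 (c : K) : (ratC c != 0) = (c != 0).
Proof. by rewrite /ratC tofrac_eq0 polyC_eq0. Qed.

Lemma phiq_neq0 : phiq != 0.
Proof. exact/cycl_q_neq0/ratX_neq0. Qed.

Lemma phiQ_neq0 a : phiQ a != 0.
Proof. by apply: cycl_Q_neq0; [rewrite ratC_neq0 | exact: ratX_neq0]. Qed.

Lemma thetaq_neq0 : thetaq != 0.
Proof. exact/cycl_q_neq0/etaK_neq0. Qed.

Lemma spz_phiq : spz ev_eta phiq thetaq.
Proof. exact: spzXz etaK_neq0 spz_y. Qed.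

Lemma spz_phiQ a : spz ev_eta (phiQ a) (thetaQ a).
Proof.
by apply: spzM; [exact/spzX/spz_ratC | exact: spzXz etaK_neq0 spz_y].
Qed.

Definition central_residue (V : Ky_mod) (j : nat) b : Prop :=
  exists2 c, psum V j = c%:M & spz ev_eta c b.

(** The scalar is a sum of products of the phi(Q_a) and powers of phi(q), all of
    which are units of O. *)
Lemma central_residue_ex (V : Ky_mod) j : simple V -> exists b, central_residue V j b.
Proof.
move=> simpleV; pose good c := exists b, spz ev_eta c b.
have goodM c c' : good c -> good c' -> good (c * c').
  by move=> [b cb] [b' cb']; exists (b * b'); apply: spzM.
have goodq : good phiq by exists thetaq; exact: spz_phiq.
have goodV : good phiq^-1.
  by exists thetaq^-1; apply: spzV; [exact: thetaq_neq0 | exact: spz_phiq].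
have goodQ a : good (phiQ a) by exists (thetaQ a); exact: spz_phiQ.
have [c goodc psumE] := simple_psum_scalar phiq_neq0 goodQ
   (fun c => goodM _ c goodq) (fun c => goodM _ c goodV) simpleV.
have [b cb] := fin_all_exists goodc.
exists (\sum_k b k ^+ j), (\sum_k c k ^+ j) => //.
by apply: spz_sum => k _; apply: spzX.
Qed.

Lemma central_residue_inj (V : Ky_mod) j b b' :
  simple V -> central_residue V j b -> central_residue V j b' -> b = b'.
Proof.
move=> [dV _] [c Vc cb] [c' Vc' cb']; apply: (spz_inj cb).
by rewrite (scalar_mx_inj_pos dV (_ : c%:M = c'%:M)) // -Vc.
Qed.

(** The scalar matrix of p_j does not depend on the basis, so p_j is this scalar
    in a lattice basis too, and its entries reduce to those of p_j on N. *)
Lemma lattice_reduction_psum (V : Ky_mod) (N : Keta_module iota eta Phi zeta n rs r) j b :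
  lattice_reduction V N -> central_residue V j b -> psum N j = b%:M.
Proof.
move=> [P [A [/row_freeP[B PB] _ PA AN]]] [c Vc cb].
pose genA k := oapp A 0 (insub k).
have genA_ord (i : 'I_n) : genA i = A i by rewrite /genA valK.
have genA_out k : (n <= k)%N -> genA k = 0.
  by move=> nk; rewrite /genA insubN // -leqNgt.
have [] := @compatible_psum _ _ _ 1%:M P phiq genA (gen V) n j.
  move=> i; case: (ltnP i n) => [ilt|igt].
    rewrite (gen_ord _ (Ordinal ilt)) (genA_ord (Ordinal ilt)).
    by split; [exact: submx1 | rewrite !mul1mx PA].
  by rewrite genA_out // gen_out //; exact: compatible0.
move=> _; rewrite !mul1mx -/(psum V j) Vc mul_mx_scalar => psumA.
have {}psumA : jm_psum phiq genA n j = c%:M.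
  by rewrite -[LHS]mulmx1 -PB mulmxA psumA -scalemxAl PB scalemx1.
have spzA : spz_mx ev_eta (jm_psum phiq genA n j) (psum N j).
  apply: spz_jm_psum; [exact: thetaq_neq0 | exact: spz_phiq |].
  move=> i a a'; case: (ltnP i n) => [ilt|igt].
    rewrite (gen_ord _ (Ordinal ilt)) (genA_ord (Ordinal ilt)).
    exact/residue_spz/AN.
  by rewrite genA_out // gen_out // !mxE; exact: spz0.
apply/matrixP => a a'; apply: (spz_inj (spzA a a')).
by rewrite psumA !mxE; case: eqP => _ //; exact: spz0.
Qed.

(** A common composition factor M of the two reductions carries both scalars,
    and M is not 0. *)
Lemma brauer_adjacent_residue (V W : Ky_mod) j b b' :
  brauer_adjacent iota eta Phi V W ->
  central_residue V j b -> central_residue W j b' -> b = b'.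
Proof.
move=> [simpleV simpleW [isoVW|]].
  move=> [c /(iso_psum_scalar isoVW) Wc cb] Wb'.
  by apply: (central_residue_inj simpleW) Wb'; exists c.
move=> [M [m [m' [[dM _] [N redN multN] [N' redN' multN'] m0 m'0]]]] Vb Wb'.
apply: (scalar_mx_inj_pos dM).
rewrite -(composition_factor_psum_scalar multN m0 (lattice_reduction_psum redN Vb)).
exact: (composition_factor_psum_scalar multN' m'0 (lattice_reduction_psum redN' Wb')).
Qed.

(** The modules along a path in the Brauer graph need not come with a label, so
    the invariant has to be defined for every simple module. *)
Lemma same_block_residue (V W : Ky_mod) j b :
  same_theta_block iota eta Phi V W ->
  central_residue V j b <-> central_residue W j b.
Proof.
elim=> {V W} [V W adj|V|V W _ IH|V U W _ IHVU _ IHUW].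
- have [simpleV simpleW _] := adj; split=> [Vb|Wb].
    have [b' Wb'] := central_residue_ex j simpleW.
    by rewrite (brauer_adjacent_residue adj Vb Wb').
  have [b' Vb'] := central_residue_ex j simpleV.
  by rewrite -(brauer_adjacent_residue adj Vb' Wb).
- by [].
- by split=> /IH.
- by split=> [/IHVU/IHUW | /IHUW/IHVU].
Qed.

Lemma ratfun_char0 k : (k%:R == 0 :> ratfun K) = (k == 0)%N.
Proof. by rewrite -(rmorph_nat (@tofrac _ \o polyC)) fmorph_eq0 char0. Qed.

Lemma adj_char0 k : (k%:R == 0 :> adj_field iota eta Phi) = (k == 0)%N.
Proof. by rewrite -(rmorph_nat (adjC iota eta Phi)) fmorph_eq0 char0. Qed.

Lemma labelled_residue (V : Ky_mod) lam j :
  is_multipartition n lam -> is_simple_labelled lam V ->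
  central_residue V j (\sum_(x <- residues thetaQ thetaq lam) x ^+ j).
Proof.
move=> lamP V_lam; have [simpleV _] := V_lam.
have [b [c Vc _]] := central_residue_ex j simpleV; exists c => //.
rewrite (labelled_psum ratfun_char0 phiQ_neq0 phiq_neq0 lamP V_lam Vc).
rewrite !big_residues; do 3!apply: spz_sum => ? _.
apply/spzX/spzM; last exact: spz_phiQ.
by apply: spzXz; [exact: thetaq_neq0 | exact: spz_phiq].
Qed.

Lemma same_block_perm_eq (V W : Ky_mod) lam mu :
  is_multipartition n lam -> is_multipartition n mu ->
  is_simple_labelled lam V -> is_simple_labelled mu W ->
  same_theta_block iota eta Phi V W ->
  perm_eq (residues thetaQ thetaq lam) (residues thetaQ thetaq mu).
Proof.
move=> lamP muP V_lam W_mu VW; apply: (psum_perm_eq adj_char0) => j.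
have [simpleW _] := W_mu; apply: (central_residue_inj (j := j) simpleW).
  by apply/(same_block_residue _ _ VW)/labelled_residue.
exact: labelled_residue.
Qed.

End Block.

(** * The Phi-adic valuation of cyclotomic monomials *)

Lemma fracE (D : idomainType) (x : {fraction D}) :
  x = (\n_(repr x))%:F / (\d_(repr x))%:F.
Proof.
have d0 : (\d_(repr x))%:F != 0 by rewrite tofrac_eq0 denom_ratioP.
apply: (canRL (mulfK d0)); rewrite -{1}[x]reprK; unlock tofrac.
rewrite -[LHS]FracField.pi_mul; apply/eqmodP.
rewrite /= FracField.equivfE /FracField.mulf.
rewrite !numden_Ratio ?mulr1 ?oner_neq0 ?denom_ratioP //.
by rewrite mulrC.
Qed.

Section Valuation.
Variables (K L : fieldType) (iota : {rmorphism K -> L}) (eta : L).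
Variables (Phi : {poly K}).
Hypothesis char0 : forall k, (k%:R == 0 :> K) = (k == 0)%N.
Hypothesis eta_neq0 : eta != 0.
Hypothesis PhiP : is_min_poly iota eta Phi.

Local Notation ev := (ev_eta iota eta Phi).
Local Notation y := (ratX K).
Local Notation etaK := (adj_root iota eta Phi).

Lemma ev_eta0_dvd p : (ev p == 0) = (Phi %| p).
Proof.
have [Phi_monic Phi_root Phi_min] := PhiP.
have Phi0 : ev Phi == 0 by rewrite (ev_eta_eq0 PhiP).
have evE : ev p = ev (p %% Phi).
  by rewrite {1}(divp_eq p Phi) rmorphD rmorphM (eqP Phi0) mulr0 add0r.
apply/idP/idP => [|/dvdpP[g ->]]; last by rewrite rmorphM (eqP Phi0) mulr0.
rewrite evE (ev_eta_eq0 PhiP) => rem_root; apply: contraT => rem0.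
have := Phi_min _ rem0 rem_root.
by rewrite leqNgt ltn_modp monic_neq0.
Qed.

(** The maximum that defines [poly_mult] runs over exponents below the size of
    the polynomial; a is one of them because Phi is not constant. *)
Lemma poly_mult_eq a p : ev p != 0 -> poly_mult Phi (Phi ^+ a * p) = a.
Proof.
have [Phi_monic Phi_root _] := PhiP; have Phi_neq0 := monic_neq0 Phi_monic.
rewrite ev_eta0_dvd => Phi_p.
have p_neq0 : p != 0 by apply: contraNneq Phi_p => ->; exact: dvdp0.
have Phi_size : (1 < size Phi)%N.
  by rewrite -(size_map_poly iota) (root_size_gt1 _ Phi_root) // map_poly_eq0.
have Phia_dvd : Phi ^+ a %| Phi ^+ a * p by exact: dvdp_mulr.
apply/eqP; rewrite eqn_leq; apply/andP; split.
  apply/bigmax_leqP => m; rewrite leqNgt; apply: contraL => am.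
  have := dvdp_exp2l Phi am; rewrite exprSr => /dvdp_trans H.
  apply/negP => /H; rewrite dvdp_mul2l ?expf_neq0 //; exact/negP.
have asize : (a < size (Phi ^+ a * p)%R)%N.
  apply: leq_trans (dvdp_leq _ Phia_dvd); last by rewrite mulf_neq0 ?expf_neq0.
  rewrite (polySpred (expf_neq0 a Phi_neq0)) size_exp ltnS leq_pmull //.
  by rewrite -ltnS prednK // ltnW.
exact: (leq_bigmax_cond (Ordinal asize)).
Qed.

Lemma Phi_factor p : p != 0 -> exists a g, p = Phi ^+ a * g /\ ev g != 0.
Proof.
have [Phi_monic Phi_root _] := PhiP; have Phi_neq0 := monic_neq0 Phi_monic.
have Phi_size : (1 < size Phi)%N.
  by rewrite -(size_map_poly iota) (root_size_gt1 _ Phi_root) // map_poly_eq0.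
have [k] := ubnP (size p); elim: k p => // k IHk p pk p0.
have [|ev_p] := boolP (ev p == 0); last by exists 0%N, p; rewrite mul1r.
rewrite ev_eta0_dvd => /dvdpP[g pE].
have g0 : g != 0 by apply: contraNneq p0 => g0; rewrite pE g0 mul0r.
have [|a [h [gE evh]]] := IHk g _ g0.
  move: pk Phi_size; rewrite pE size_mul // => {pE}.
  by move: (size g) (size Phi) => s t; lia.
by exists a.+1, h; rewrite pE gE exprSr mulrAC.
Qed.

(** The factor u is a unit of the localisation at Phi, so e is the valuation
    of x. *)
Definition has_defect (x : ratfun K) (e : nat) : Prop :=
  exists2 u, x = (Phi%:F) ^+ e * u & exists2 b, spz ev u b & b != 0.

Lemma has_defect_unit x b : spz ev x b -> b != 0 -> has_defect x 0.
Proof. by move=> xb b0; exists x; [rewrite mul1r | exists b]. Qed.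

Lemma has_defectM x x' e e' :
  has_defect x e -> has_defect x' e' -> has_defect (x * x') (e + e').
Proof.
move=> [u -> [b ub b0]] [u' -> [b' ub' b0']].
exists (u * u'); first by rewrite mulrACA exprD.
by exists (b * b'); [exact: spzM | exact: mulf_neq0].
Qed.

Lemma has_defect_prod (I : Type) (s : seq I) (P : pred I) x e :
  (forall i, P i -> has_defect (x i) (e i)) ->
  has_defect (\prod_(i <- s | P i) x i) (\sum_(i <- s | P i) e i)%N.
Proof.
move=> xe; elim/big_rec2: _ => [|i e' x' Pi].
  by apply: has_defect_unit (spz1 _) _; exact: oner_neq0.
by apply: has_defectM; exact: xe.
Qed.

Lemma valuation_defect x e : has_defect x e -> valuation Phi x = e%:Z.
Proof.
move=> [u xE [b [p [g [evg uE bE]]] b0]].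
have evp : ev p != 0 by apply: contraNneq b0 => evp; rewrite bE evp mul0r.
have ev_neq0 h : ev h != 0 -> h != 0.
  by apply: contraNneq => ->; rewrite rmorph0.
have Phi_neq0 : Phi != 0 by case: PhiP => /monic_neq0.
have d_neq0 : \d_(repr x) != 0 by exact: denom_ratioP.
have gF : g%:F != 0 by rewrite tofrac_eq0 ev_neq0.
have dF : (\d_(repr x))%:F != 0 by rewrite tofrac_eq0.
have : \n_(repr x) * g = Phi ^+ e * p * \d_(repr x).
  have : (\n_(repr x))%:F / (\d_(repr x))%:F = (Phi ^+ e * p)%:F / g%:F.
    by rewrite -fracE xE uE tofracM tofracXn mulrA.
  move/eqP.
  by rewrite (eqr_div _ _ dF gF) -!tofracM tofrac_eq => /eqP.
have n_neq0 : \n_(repr x) != 0.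
  have PhiF : Phi%:F != 0 by rewrite tofrac_eq0.
  have pF : p%:F != 0 by rewrite tofrac_eq0 ev_neq0.
  have x0 : x != 0.
    rewrite xE uE.
    by rewrite (mulf_neq0 (expf_neq0 e PhiF) (mulf_neq0 pF (invr_neq0 gF))).
  by apply: contraNneq x0 => n0; rewrite {1}[x]fracE n0 tofrac0 mul0r.
have [a [d' [dE evd]]] := Phi_factor d_neq0.
have [a' [n' [nE evn]]] := Phi_factor n_neq0.
rewrite /valuation {}nE {}dE !poly_mult_eq // => E.
have : Phi ^+ a' * (n' * g) = Phi ^+ (e + a) * (p * d').
  by rewrite mulrA E exprD mulrACA.
move/(congr1 (poly_mult Phi)); rewrite !poly_mult_eq ?rmorphM ?mulf_neq0 // => ->.
by rewrite PoszD addrK.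
Qed.

Lemma monomial_eq1 (c : K) (N : int) : c != 0 ->
  ratC c * y ^ N = 1 -> N = 0 /\ c = 1.
Proof.
move=> c0; case: N => k.
  rewrite -exprnP.
  have -> : ratC c * y ^+ k = (c%:P * 'X^k)%:F by rewrite tofracM tofracXn.
  rewrite -tofrac1 => /eqP; rewrite tofrac_eq.
  case: k => [/eqP|k /eqP/(congr1 (horner^~ 0))].
    by rewrite mulr1 => /polyC_inj ->.
  by rewrite !hornerE expr0n mulr0 => /esym/eqP; rewrite oner_eq0.
have yk : y ^+ k.+1 != 0 by rewrite expf_neq0 // ratX_neq0.
move/(canRL (mulfVK yk)); rewrite mul1r /ratC /ratX -tofracXn => /eqP.
rewrite tofrac_eq => /eqP/(congr1 (horner^~ 0)).
by rewrite !hornerE expr0n => /eqP; rewrite (negPf c0).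
Qed.

(** If eta is a root of p = c X^N - 1 with N > 0, then it is a simple root:
    p' = N c X^(N-1) does not vanish at eta, as eta is not 0 and the
    characteristic is 0. The case N < 0 reduces to this one by factoring out
    -c y^N; if N = 0, a root at eta would force c = 1. *)
Lemma monomial_defect (c : K) (N : int) : c != 0 -> ratC c * y ^ N != 1 ->
  has_defect (ratC c * y ^ N - 1)
    (adjC iota eta Phi c * etaK ^ N == 1).
Proof.
move=> c0 cN.
have eta0 := etaK_neq0 eta_neq0 PhiP.
have spzx c' N' : spz ev (ratC c' * y ^ N' - 1) (adjC iota eta Phi c' * etaK ^ N' - 1).
  apply: spzD; last exact/spzN/spz1.
  by apply: spzM; [exact: spz_ratC | exact: spzXz eta0 (spz_y _ _ _)].
have [cE|] := eqVneq; last first.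
  by rewrite -subr_eq0; exact: has_defect_unit.
have pos c' k : adjC iota eta Phi c' * etaK ^+ k.+1 = 1 ->
    has_defect (ratC c' * y ^+ k.+1 - 1) 1.
  move=> cE'; pose p := c'%:P * 'X^(k.+1) - 1.
  have -> : ratC c' * y ^+ k.+1 - 1 = p%:F.
    by rewrite /p tofracB tofracM tofracXn tofrac1.
  have evp : ev p == 0.
    by rewrite rmorphB rmorphM rmorphXn rmorph1 subr_eq0; exact/eqP.
  have /dvdpP[g pE] : Phi %| p by rewrite -ev_eta0_dvd.
  exists g%:F; first by rewrite expr1 pE tofracM mulrC.
  exists (ev g); first exact: spz_tofrac.
  have evPhi : ev Phi = 0 by apply/eqP; rewrite ev_eta0_dvd.
  (* p = g Phi, so p' takes at eta the value of g Phi' *)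
  have : ev p^`() != 0.
    rewrite /p derivB derivM derivXn derivC mul0r add0r -polyC1 derivC subr0.
    rewrite mulrnAr -mulr_natr !rmorphM rmorphXn rmorph_nat.
    rewrite !mulf_neq0 // ?adj_char0 // ?expf_neq0 //.
    apply: contra_eq_neq cE' => c'0; rewrite [X in X * _]c'0 mul0r.
    by rewrite eq_sym oner_neq0.
  rewrite pE derivM rmorphD !rmorphM evPhi mulr0 add0r.
  by apply: contraNneq => ->; rewrite mul0r.
case: N cN cE => [[|k]|k] cN cE.
- rewrite !mulr1 in cN cE; case/eqP: cN.
  suff -> : c = 1 by rewrite /ratC polyC1 tofrac1.
  by apply: (fmorph_inj (adjC iota eta Phi)); rewrite rmorph1; exact: cE.
- exact: pos.
have y0 := ratX_neq0 K.
have cF : ratC c != 0 by rewrite ratC_neq0.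
have -> : ratC c * y ^ Negz k - 1 =
    - (ratC c * y ^ Negz k) * (ratC c^-1 * y ^+ k.+1 - 1).
  have -> : ratC c^-1 = (ratC c)^-1.
    by apply: (mulfI cF); rewrite mulfV // /ratC -tofracM -polyCM mulfV.
  have yy : y ^ Negz k * y ^+ k.+1 = 1 by exact: mulVf (expf_neq0 k.+1 y0).
  by rewrite mulNr mulrBr mulr1 mulrACA (mulfV cF) yy mul1r opprB.
rewrite -[nat_of_bool _]add0n; apply: has_defectM.
  apply: (has_defect_unit (b := - (adjC iota eta Phi c * etaK ^ Negz k))).
    apply/spzN/spzM; [exact: spz_ratC | exact: spzXz eta0 (spz_y _ _ _)].
  by rewrite cE oppr_eq0 oner_neq0.
apply: pos.
have -> : adjC iota eta Phi c^-1 = (adjC iota eta Phi c)^-1.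
  exact: (fmorphV (adjC iota eta Phi) c).
by have := congr1 GRing.inv cE; rewrite invfM invrK invr1.
Qed.

End Valuation.

(** * Vanishing hook factors counted through residues *)

Lemma conj_partE (s : seq nat) j :
  conj_part s j.+1 = conj_row (nth 0%N s) (size s) j.
Proof.
rewrite /conj_part -sum1_count (big_nth 0%N) big_mkord big_mkcond /=.
by apply: eq_bigr => k _; case: ltnP.
Qed.

Lemma ghookE (s t : seq nat) i j :
  ghook s t i.+1 j.+1 =
  (nth 0%N s i + conj_row (nth 0%N t) (size t) j)%:Z - (i + j).+1%:Z.
Proof. rewrite /ghook /part conj_partE /=; lia. Qed.

Lemma partition_nth s : is_partition s ->
  {homo nth 0%N s : i j / (i <= j)%N >-> (j <= i)%N}.
Proof.
move=> /andP[sorted_s _] i j ij; have [js|js] := ltnP j (size s); last first.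
  by rewrite (nth_default _ js).
have si := leq_ltn_trans ij js.
apply: (sorted_leq_nth _ _ 0%N sorted_s) => //; last exact: leqnn.
by move=> ? ? ? /= h1 h2; exact: leq_trans h2 h1.
Qed.

Section ResidueCount.
Variables (F : fieldType) (l : nat) (Q : 'I_l -> F) (q : F).
Hypothesis q_neq0 : q != 0.

(** The pairs of a node, in component a say, and a component b, such that the
    factor q^h Q_a / Q_b - 1 vanishes; b = a is included. *)
Definition hook_count (lam : 'I_l -> seq nat) : nat :=
  (\sum_a \sum_(i < size (lam a)) \sum_(j < nth 0 (lam a) i) \sum_b
    (q ^ ghook (lam a) (lam b) i.+1 j.+1 * Q a == Q b)%R)%N.

(** [diff2] applied to the indicator function of q^k x = y, at k = 0. *)
Definition residue_form (x y : F) : int :=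
  2 * (x == y)%:Z - (q * x == y)%:Z - (q^-1 * x == y)%:Z.

Lemma big_residues_box lam (f : F -> int) :
  \sum_(x <- residues Q q lam) f x =
  \sum_a box_sum (nth 0%N (lam a)) (size (lam a))
     (fun i j => f (q ^ (j%:Z - i%:Z) * Q a)).
Proof. exact: big_residues. Qed.

Lemma residue_shift (a b : 'I_l) (e c c' : int) :
  (q ^ (c - c' + e) * Q a == Q b) = (q ^ e * (q ^ c * Q a) == q ^ c' * Q b).
Proof.
rewrite -(inj_eq (mulfI (expfz_neq0 c' q_neq0))) !mulrA -!expfzDr //.
by congr (q ^ _ * _ == _); lia.
Qed.

(** Apply [hook_content_identity] to each ordered pair (a, b) of components and
    to the indicator f of q^k Q_a = Q_b. Replacing k by -k exchanges the roles
    of a and b, so both sums of hooks on the left give the hook count. *)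
Lemma hook_count_residues lam : (forall a, is_partition (lam a)) ->
  2 * (hook_count lam)%:Z =
  2 * \sum_(x <- residues Q q lam) \sum_b (x == Q b)%:Z
  - \sum_(x <- residues Q q lam) \sum_(y <- residues Q q lam) residue_form x y.
Proof.
move=> lamP; pose row a := nth 0%N (lam a); pose m a := size (lam a).
pose f a b (k : int) : int := (q ^ k * Q a == Q b)%:Z.
have fN a b k : f a b (- k) = f b a k.
  rewrite /f -[- k]addr0 -[in LHS](sub0r k) residue_shift !expr0z !mul1r.
  by rewrite eq_sym.
pose h a b i j : int := (row a i + conj_row (row b) (m b) j)%:Z - (i + j).+1%:Z.
have countE : (hook_count lam)%:Z =
    \sum_a \sum_b box_sum (row a) (m a) (fun i j => f a b (h a b i j)).
  rewrite /hook_count /box_sum -natz natr_sum; apply: eq_bigr => a _.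
  rewrite natr_sum [RHS]exchange_big; apply: eq_bigr => i _.
  rewrite natr_sum [RHS]exchange_big; apply: eq_bigr => j _.
  rewrite natr_sum; apply: eq_bigr => b _.
  by rewrite ghookE natz.
have count_sym : (hook_count lam)%:Z =
    \sum_a \sum_b box_sum (row b) (m b) (fun i j => f a b (- h b a i j)).
  rewrite countE exchange_big; apply: eq_bigr => a _; apply: eq_bigr => b _.
  by do 2!apply: eq_bigr => ? _; rewrite fN.
pose X a b := box_sum (row a) (m a) (fun i j => f a b (j%:Z - i%:Z)).
pose Y a b := box_sum (row b) (m b) (fun i j => f a b (i%:Z - j%:Z)).
pose Z a b := box_sum (row a) (m a) (fun i j => box_sum (row b) (m b)
  (fun i' j' => diff2 (f a b) ((j%:Z - i%:Z) - (j'%:Z - i'%:Z)))).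
have XE : \sum_a \sum_b X a b =
    \sum_(x <- residues Q q lam) \sum_b (x == Q b)%:Z.
  rewrite big_residues_box; apply: eq_bigr => a _; rewrite /X /box_sum.
  rewrite exchange_big; apply: eq_bigr => i _.
  by rewrite exchange_big.
have YE : \sum_a \sum_b Y a b = \sum_a \sum_b X a b.
  rewrite exchange_big; apply: eq_bigr => a _; apply: eq_bigr => b _.
  by do 2!apply: eq_bigr => ? _; rewrite -fN opprB.
have ZE : \sum_a \sum_b Z a b = \sum_(x <- residues Q q lam)
    \sum_(y <- residues Q q lam) residue_form x y.
  rewrite big_residues_box; apply: eq_bigr => a _; rewrite /Z /box_sum.
  rewrite exchange_big; apply: eq_bigr => i _.
  rewrite exchange_big; apply: eq_bigr => j _.
  rewrite big_residues_box; apply: eq_bigr => b _.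
  apply: eq_bigr => i' _; apply: eq_bigr => j' _.
  rewrite /diff2 /f /residue_form -[X in 2 * (q ^ X * _ == _)%:Z]addr0.
  by rewrite !residue_shift expr0z mul1r expr1z exprN1.
rewrite -ZE (_ : 2 = 1 + 1) // !mulrDl !mul1r {1}countE count_sym -XE -{2}YE.
rewrite -!big_split -sumrB /=; apply: eq_bigr => a _.
rewrite -!big_split -sumrB /=; apply: eq_bigr => b _.
by apply: hook_content_identity; exact: partition_nth.
Qed.

End ResidueCount.

(** * The defect as a number of vanishing hook factors *)

Lemma big_from1 (V : Type) (idx : V) (op : V -> V -> V) m (f : nat -> V) :
  \big[op/idx]_(1 <= i < m.+1) f i = \big[op/idx]_(i < m) f i.+1.
Proof. by rewrite big_add1 big_mkord. Qed.

Lemma ghook_gt0 s i j : is_partition s -> (i < size s)%N ->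
  (j < nth 0%N s i)%N -> 0 < ghook s s i.+1 j.+1.
Proof.
move=> /partition_nth s_mono si js; rewrite ghookE.
by have := conj_row_gt s_mono si js; move: js; lia.
Qed.

Section SchurDefect.
Variables (K L : fieldType) (iota : {rmorphism K -> L}) (eta : L).
Variables (Phi : {poly K}) (zeta : K).
Variables (n l : nat) (rs : 'I_l -> int) (r : int).
Hypothesis char0 : forall k, (k%:R == 0 :> K) = (k == 0)%N.
Hypotheses (eta_neq0 : eta != 0) (zeta_neq0 : zeta != 0).
Hypothesis zeta_inj : injective (fun a : 'I_l => zeta ^+ a).
Hypothesis PhiP : is_min_poly iota eta Phi.

Local Notation ev := (ev_eta iota eta Phi).
Local Notation y := (ratX K).
Local Notation etaK := (adj_root iota eta Phi).
Local Notation zetaK := (adjC iota eta Phi zeta).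
Local Notation phiQ := (cycl_Q rs (ratC zeta) y).
Local Notation phiq := (cycl_q r y).
Local Notation thetaQ := (cycl_Q rs zetaK etaK).
Local Notation thetaq := (cycl_q r etaK).
Local Notation has_defect := (has_defect iota eta Phi).

Lemma cycl_qX (F : fieldType) (r' : int) (y' : F) (h : int) :
  cycl_q r' y' ^ h = y' ^ (r' * h).
Proof. by rewrite /cycl_q exprz_exp. Qed.

Lemma cycl_factor (F : fieldType) (z y' : F) (h : int) (a b : 'I_l) :
  y' != 0 -> z != 0 ->
  cycl_q r y' ^ h * cycl_Q rs z y' a * (cycl_Q rs z y' b)^-1 =
  (z ^+ a / z ^+ b) * y' ^ (r * h + rs a - rs b).
Proof.
move=> y0 z0; rewrite cycl_qX /cycl_Q invfM invr_expz !expfzDr //.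
move: (y' ^ (r * h)) (y' ^ rs a) (y' ^ (- rs b)) (z ^+ a) (z ^+ b)^-1.
by move=> ? ? ? ? ?; ring.
Qed.

Lemma ratCM c c' : ratC (c * c') = ratC c * ratC c' :> ratfun K.
Proof. by rewrite /ratC polyCM tofracM. Qed.

Lemma ratC_div a b : ratC (zeta ^+ a / zeta ^+ b) = ratC zeta ^+ a / ratC zeta ^+ b.
Proof.
have zb : zeta ^+ b != 0 by rewrite expf_neq0.
have XE k : ratC zeta ^+ k = ratC (zeta ^+ k) by rewrite /ratC polyC_exp tofracXn.
rewrite !XE; have zb' : ratC (zeta ^+ b) != 0 by rewrite ratC_neq0.
by apply: (canRL (mulfK zb')); rewrite -ratCM divfK.
Qed.

Lemma factor_defect (h : int) (a b : 'I_l) : b != a ->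
  has_defect (phiq ^ h * phiQ a * (phiQ b)^-1 - 1)
    (thetaq ^ h * thetaQ a == thetaQ b).
Proof.
move=> ba; have y0 := ratX_neq0 K; have eta0 := etaK_neq0 eta_neq0 PhiP.
have z0 : ratC zeta != 0 by rewrite ratC_neq0.
have zK0 : zetaK != 0 by exact: zetaK_neq0.
set c := zeta ^+ a / zeta ^+ b; set N := r * h + rs a - rs b.
have c0 : c != 0 by rewrite mulf_neq0 ?invr_eq0 ?expf_neq0.
have -> : phiq ^ h * phiQ a * (phiQ b)^-1 = ratC c * y ^ N.
  by rewrite (cycl_factor _ _ _ y0 z0) ratC_div.
have -> : (thetaq ^ h * thetaQ a == thetaQ b) = (adjC iota eta Phi c * etaK ^ N == 1).
  have Qb := cycl_Q_neq0 rs b zK0 eta0.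
  rewrite -(inj_eq (mulIf (invr_neq0 Qb))) (mulfV Qb) (cycl_factor _ _ _ eta0 zK0).
  have -> : adjC iota eta Phi c = zetaK ^+ a / zetaK ^+ b; last by [].
  by rewrite [LHS](fmorph_div (adjC iota eta Phi)) !(rmorphXn (adjC iota eta Phi)).
apply: (monomial_defect char0 eta_neq0 PhiP c0).
apply: contraNneq ba => /(monomial_eq1 c0)[_ c1]; apply/eqP/zeta_inj.
by rewrite -[LHS]mul1r -c1 divfK // expf_neq0.
Qed.

(** If theta(q) = 1 the value of [h]_q at eta is the number h, which is not 0.
    Otherwise [h]_q = (q^h - 1) / (q - 1), where the denominator is a unit. *)
Lemma qint_defect (h : int) : 0 < h ->
  has_defect (qint phiq h) ((thetaq != 1) && (thetaq ^ h == 1)).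
Proof.
case: h => // h h0; have y0 := ratX_neq0 K; have eta0 := etaK_neq0 eta_neq0 PhiP.
have spzq : spz ev phiq thetaq by exact: spz_phiq.
have [q1|q1] := eqVneq thetaq 1 => /=.
  apply: (has_defect_unit (b := h%:R)); last by rewrite adj_char0 // -lt0n.
  have -> : h%:R = \sum_(i < h) thetaq ^+ i.
    by under eq_bigr do rewrite q1 expr1n; rewrite sumr_const card_ord.
  by rewrite /qint big_mkord; apply: spz_sum => i _; exact: spzX.
have r0 : r != 0 by apply: contra_neq q1 => ->.
have spzq1 : spz ev (phiq - 1) (thetaq - 1) by exact/spzD/spzN/spz1.
have th1 : thetaq - 1 != 0 by rewrite subr_eq0.
have ph1 : phiq - 1 != 0.
  by apply: contraNneq th1 => ph1; rewrite ph1 in spzq1; rewrite (spz_inj spzq1 (spz0 _)).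
have -> : qint phiq h = (phiq - 1)^-1 * (ratC 1 * y ^ (r * h) - 1).
  apply: (canRL (mulKf ph1)); rewrite /qint big_mkord -subrX1.
  by rewrite exprnP cycl_qX /ratC polyC1 tofrac1 mul1r.
rewrite -[nat_of_bool _]add0n; apply: has_defectM.
  by apply: has_defect_unit (spzV th1 spzq1) _; rewrite invr_eq0.
have -> : thetaq ^ h = adjC iota eta Phi 1 * etaK ^ (r * h).
  have -> : adjC iota eta Phi 1 = 1 by exact: rmorph1.
  by rewrite cycl_qX mul1r.
apply: (monomial_defect char0 eta_neq0 PhiP (oner_neq0 K)).
apply/eqP => /(monomial_eq1 (oner_neq0 _))[/eqP].
by rewrite mulf_eq0 (negPf r0) /= => /eqP[h00]; rewrite h00 in h0.
Qed.

(** The first summand is the contribution of [h]_q, the others those of the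
    factors that involve a second component. *)
Definition schur_defect (lam : 'I_l -> seq nat) : nat :=
  (\sum_a \sum_(i < size (lam a)) \sum_(j < nth 0 (lam a) i)
    let h b := ghook (lam a) (lam b) i.+1 j.+1 in
    (((thetaq != 1) && (thetaq ^ h a == 1))%R +
     \sum_(b | b != a) (thetaq ^ h b * thetaQ a == thetaQ b)%R))%N.

Lemma schur_element_defect lam : is_multipartition n lam ->
  has_defect (schur_element n phiQ phiq lam) (schur_defect lam).
Proof.
move=> [lamP _]; rewrite -[schur_defect lam]add0n; apply: has_defectM.
  apply: (has_defect_unit (b := (-1) ^+ (n * l.-1) *
      thetaq ^ (- (partN (all_parts lam))%:Z))).
    apply: spzM; first exact/spzX/spzN/spz1.
    by apply: spzXz; [exact: thetaq_neq0 | exact: spz_phiq].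
  have m1 : -1 != 0 :> adj_field iota eta Phi by rewrite oppr_eq0 oner_neq0.
  exact: mulf_neq0 (expf_neq0 _ m1)
    (expfz_neq0 _ (thetaq_neq0 r eta_neq0 PhiP)).
apply: has_defect_prod => a _; rewrite big_from1; apply: has_defect_prod => i _.
rewrite big_from1; apply: has_defect_prod => j _; apply: has_defectM.
  by apply/qint_defect/ghook_gt0.
by apply: has_defect_prod => b ba; apply: factor_defect.
Qed.

(** If theta(q) = 1, the pairs with b = a all count as vanishing hooks, one for
    each of the n nodes, while the factors [h]_q are units. *)
Lemma schur_defect_hook_count lam : is_multipartition n lam ->
  (schur_defect lam + (thetaq == 1)%R * n)%N = hook_count thetaQ thetaq lam.
Proof.
move=> lamP; rewrite -[X in (_ * X)%N](sum_parts lamP) /schur_defect /hook_count.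
rewrite big_distrr -big_split; apply: eq_bigr => a _ /=.
rewrite big_distrr -big_split; apply: eq_bigr => i _ /=.
rewrite big_distrr -big_split; apply: eq_bigr => j _ /=.
rewrite muln1 addnAC [RHS](bigD1 a) //=; congr (_ + _)%N.
have Qa : thetaQ a != 0 by apply: cycl_Q_neq0; [exact: zetaK_neq0 | exact: etaK_neq0].
have hookE (h : int) : (thetaq ^ h * thetaQ a == thetaQ a) = (thetaq ^ h == 1).
  by rewrite -[X in _ == X]mul1r (inj_eq (mulIf Qa)).
by rewrite hookE; case: eqVneq => [->|] //; rewrite ?exp1rz ?eqxx ?addn0.
Qed.

End SchurDefect.

(** * Powers of the root of unity, and the theorem *)

Section Cyclotomic.
Variables (R : realType) (l : nat).
Hypothesis l_gt0 : (0 < l)%N.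

Lemma eta_l_power k :
  eta_l R l ^+ k =
  (cos ((2 * pi / l%:R) *+ k) +i* sin ((2 * pi / l%:R) *+ k))%C.
Proof.
elim: k => [|k IHk]; first by rewrite expr0 mulr0n cos0 sin0.
rewrite exprS IHk /eta_l; move: (2 * pi / l%:R) => t; rewrite mulrS cosD sinD.
simpc.
by congr (_ +i* _)%C; rewrite addrC.
Qed.

Lemma eta_l_order : eta_l R l ^+ l = 1.
Proof.
rewrite eta_l_power -mulr_natr divfK ?pnatr_eq0 -?lt0n //.
by rewrite mulr_natl cos2pi sin2pi.
Qed.

Lemma eta_l_neq1 k : (0 < k < l)%N -> eta_l R l ^+ k != 1.
Proof.
move=> /andP[k0 kl]; rewrite eta_l_power; apply/eqP => -[cos1 _].
pose t : R := pi * k%:R / l%:R.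
have tE : (2 * pi / l%:R) *+ k = t *+ 2.
  by rewrite /t mulr2n -[LHS]mulr_natr; ring.
have l0 : 0 < l%:R :> R by rewrite ltr0n.
have t0 : 0 < t by rewrite /t divr_gt0 // mulr_gt0 ?pi_gt0 // ltr0n.
have tpi : t < pi by rewrite /t ltr_pdivrMr // ltr_pM2l ?pi_gt0 // ltr_nat.
have sin0 : 0 < sin t by apply: sin_gt0_pi; rewrite t0 tpi.
move: cos1; rewrite tE cos_mulr2n => cos1.
have := cos2Dsin2 t; have : 0 < sin t ^+ 2 by rewrite exprn_gt0.
lra.
Qed.

Lemma cycl_char0 k : (k%:R == 0 :> cycl_field R l) = (k == 0)%N.
Proof. by rewrite -(fmorph_eq0 (cycl_emb R l)) rmorph_nat pnatr_eq0. Qed.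

Lemma cycl_emb_root : cycl_emb R l (cycl_root R l) = eta_l R l.
Proof.
apply: subfx_inj_root.
  rewrite rootE rmorphB rmorphXn rmorph1 /= map_polyX !hornerE eta_l_order.
  by rewrite subrr.
by rewrite -size_poly_gt0 size_XnsubC.
Qed.

Lemma cycl_root_neq0 : cycl_root R l != 0.
Proof.
rewrite -(fmorph_eq0 (cycl_emb R l)) cycl_emb_root; apply/eqP => eta0.
have := eta_l_order; rewrite eta0 expr0n gtn_eqF // => /esym/eqP.
by rewrite oner_eq0.
Qed.

(** This keeps the factors q^h Q_a / Q_b - 1 of the Schur element from being 0
    when the exponent of y is 0. *)
Lemma cycl_root_inj : injective (fun a : 'I_l => cycl_root R l ^+ a).
Proof.
have lt_neq (a b : 'I_l) : (a < b)%N -> cycl_root R l ^+ a != cycl_root R l ^+ b.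
  move=> ab; have [c cE] : exists c, (b = a + c :> nat)%N by exists (b - a)%N; lia.
  rewrite cE exprD -[X in X != _]mulr1 (inj_eq (mulfI _)) ?expf_neq0 ?cycl_root_neq0 //.
  rewrite eq_sym -(inj_eq (fmorph_inj (cycl_emb R l))) rmorphXn rmorph1 /=.
  rewrite -/(cycl_emb R l _) cycl_emb_root eta_l_neq1 //.
  by have := ltn_ord b; lia.
move=> a b ab; apply: val_inj; apply/eqP; case: ltngtP => // ltab.
  by have := lt_neq _ _ ltab; rewrite ab eqxx.
by have := lt_neq _ _ ltab; rewrite ab eqxx.
Qed.

End Cyclotomic.

Theorem theorem3p4p1 (R : realType) (n l : nat) (l_gt0 : (0 < l)%N)
    (rs : 'I_l -> int) (r : int)
    (eta : R[i]) (eta_neq0 : eta != 0)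
    (eta_alg : algebraicOver (cycl_emb R l) eta)
    (Phi : {poly cycl_field R l})
    (PhiP : is_min_poly (cycl_emb R l) eta Phi)
    (lam mu : 'I_l -> seq nat)
    (lamP : is_multipartition n lam) (muP : is_multipartition n mu)
    (V W : Ky_module (cycl_root R l) n rs r)
    (V_lam : is_simple_labelled lam V) (W_mu : is_simple_labelled mu W) :
  same_theta_block (cycl_emb R l) eta Phi V W ->
  let phiQ := cycl_Q rs (ratC (cycl_root R l)) (ratX (cycl_field R l)) in
  let phiq := cycl_q r (ratX (cycl_field R l)) in
  valuation Phi (schur_element n phiQ phiq lam) =
  valuation Phi (schur_element n phiQ phiq mu).
Proof.
move=> VW phiQ phiq.
have char0 := cycl_char0 R l; have zeta0 := cycl_root_neq0 R l_gt0.
have zeta_inj := cycl_root_inj (R := R) l_gt0.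
have residues_eq := same_block_perm_eq char0 eta_neq0 zeta0 PhiP lamP muP V_lam W_mu VW.
have defect nu : is_multipartition n nu ->
    valuation Phi (schur_element n phiQ phiq nu) =
    (schur_defect (cycl_emb R l) eta Phi (cycl_root R l) rs r nu)%:Z.
  move=> nuP; apply: (valuation_defect eta_neq0 PhiP).
  exact: (schur_element_defect rs r char0 eta_neq0 zeta0 zeta_inj PhiP nuP).
rewrite (defect _ lamP) (defect _ muP).
have count nu (nuP : is_multipartition n nu) :=
  schur_defect_hook_count rs r eta_neq0 zeta0 PhiP nuP.
move: (count _ lamP) (count _ muP).
set q := cycl_q _ _; set Q := cycl_Q _ _ _ => lam_count mu_count.
have q0 : q != 0 by exact: thetaq_neq0.
suff : 2 * (hook_count Q q lam)%:Z = 2 * (hook_count Q q mu)%:Z.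
  by rewrite -lam_count -mu_count; lia.
have [lam_part _] := lamP; have [mu_part _] := muP.
rewrite !hook_count_residues // (perm_big _ residues_eq); congr (_ - _).
by rewrite (perm_big _ residues_eq); apply: eq_bigr => x _; apply: perm_big.
Qed.
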